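(* Let $g\in H(\mathbb{D})$ and let $\nu,\mu$ be weights. Then the following are equivalent: (1) $S_g: \mathcal{B}^{\infty}_\nu\rightarrow \mathcal{B}^{\infty}_\mu$ is bounded; (2) $\sup_{z\in\mathbb{D}}|g(z)|\,\mu(z)/\widetilde{\nu}(z)<\infty$. If, in addition, $\nu$ and $\mu$ are typical weights, then (1) and (2) are also equivalent to (3) $S_g: \mathcal{B}^{0}_\nu\rightarrow \mathcal{B}^{0}_\mu$ is bounded.
   Context: $\mathbb{D}$ is the open unit disk and $H(\mathbb{D})$ the space of analytic functions on $\mathbb{D}$. A weight is a non-negative continuous function $\nu$ on $\mathbb{D}$ with $\nu(z)=\nu(|z|)$ for all $z$, which is decreasing in $|z|$. For a weight $\nu$: $H^{\infty}_\nu=\{f\in H(\mathbb{D}): \|f\|_{H^\infty_\nu}=\sup_{z}\nu(z)|f(z)|<\infty\}$; $\mathcal{B}^{\infty}_\nu=\{f\in H(\mathbb{D}): \|f\|=|f(0)|+\sup_{z}\nu(z)|f'(z)|<\infty\}$; $\mathcal{B}^{0}_\nu=\{f\in H(\mathbb{D}): \lim_{|z|\to1^-}\nu(z)|f'(z)|=0\}$ (with the norm of $\mathcal{B}^\infty_\nu$). The associated weight of $\nu$ is $\widetilde{\nu}(z)=1/\sup\{|f(z)|: f\in H^\infty_\nu,\ \|f\|_{H^\infty_\nu}\le 1\}$. A weight $\nu$ is typical if $\lim_{|z|\to1^-}\nu(z)=0$. For $g\in H(\mathbb{D})$, $(S_gf)(z)=\int_0^z f'(\omega)g(\omega)\,d\omega$.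 *)

(* Defs.v *)
From Stdlib Require Import Reals ClassicalEpsilon.
From Coquelicot Require Import Coquelicot.
Open Scope R_scope.

Definition inD (z : C) : Prop := Cmod z < 1.

Definition holoD (f : C -> C) : Prop :=
  forall z : C, inD z -> ex_derive (K := C_AbsRing) (V := C_NormedModule) f z.

(* the complex derivative f'(z) (chosen value; meaningful where f is
   complex differentiable) *)
Definition Cderiv (f : C -> C) (z : C) : C :=
  epsilon (inhabits (0%R : R, 0%R : R))
    (fun l : C => is_derive (K := C_AbsRing) (V := C_NormedModule) f z l).

Definition weight (nu : C -> R) : Prop :=
  (forall z, inD z -> 0 <= nu z) /\
  (forall z, inD z -> continuous (fun w : C => nu w) z) /\
  (forall z, inD z -> nu z = nu (RtoC (Cmod z))) /\
  (forall z w, inD z -> inD w -> Cmod z <= Cmod w -> nu w <= nu z).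

Definition typical (nu : C -> R) : Prop :=
  forall eps : R, 0 < eps -> exists r : R, r < 1 /\
    forall z, inD z -> r < Cmod z -> nu z < eps.

Definition supD (F : C -> R) : Rbar :=
  Lub_Rbar (fun x : R => exists z, inD z /\ x = F z).

Definition Hinf_norm (nu : C -> R) (f : C -> C) : Rbar :=
  supD (fun z => nu z * Cmod (f z)).
Definition in_Hinf (nu : C -> R) (f : C -> C) : Prop :=
  holoD f /\ is_finite (Hinf_norm nu f).

Definition Bseminorm (nu : C -> R) (f : C -> C) : Rbar :=
  supD (fun z => nu z * Cmod (Cderiv f z)).
Definition in_Binf (nu : C -> R) (f : C -> C) : Prop :=
  holoD f /\ is_finite (Bseminorm nu f).
Definition Bnorm (nu : C -> R) (f : C -> C) : R :=
  Cmod (f (RtoC 0)) + real (Bseminorm nu f).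
Definition in_B0 (nu : C -> R) (f : C -> C) : Prop :=
  holoD f /\
  forall eps : R, 0 < eps -> exists r : R, r < 1 /\
    forall z, inD z -> r < Cmod z -> nu z * Cmod (Cderiv f z) < eps.

(* associated weight: nu~(z) = 1 / sup{|f(z)| : f in H^infty_nu, ||f|| <= 1},
   with the convention 1/(+oo) = 0 (the sup is always >= 0 is attained by f=0,
   and positive when nu(0) > 0). *)
Definition assoc_sup (nu : C -> R) (z : C) : Rbar :=
  Lub_Rbar (fun x : R => exists f : C -> C,
    in_Hinf nu f /\ Rbar_le (Hinf_norm nu f) 1 /\ x = Cmod (f z)).
Definition assoc_weight (nu : C -> R) (z : C) : R :=
  match assoc_sup nu z with
  | Finite s => / s
  | _ => 0
  end.

(* S_g f (z) = int_0^z f'(w) g(w) dw, along the segment [0,z] *)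
Definition Sg (g f : C -> C) (z : C) : C :=
  RInt (V := C_R_CompleteNormedModule)
    (fun t : R => Cmult (Cmult (Cderiv f (Cmult (RtoC t) z)) (g (Cmult (RtoC t) z))) z)
    0 1.

Definition Sg_bounded_Binf (g : C -> C) (nu mu : C -> R) : Prop :=
  exists K : R, forall f : C -> C, in_Binf nu f ->
    in_Binf mu (Sg g f) /\ Bnorm mu (Sg g f) <= K * Bnorm nu f.

Definition Sg_bounded_B0 (g : C -> C) (nu mu : C -> R) : Prop :=
  exists K : R, forall f : C -> C, in_B0 nu f ->
    in_B0 mu (Sg g f) /\ Bnorm mu (Sg g f) <= K * Bnorm nu f.

(* sup_z |g(z)| mu(z) / nu~(z) < infty  (division-free form) *)
Definition cond2 (g : C -> C) (nu mu : C -> R) : Prop :=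
  exists K : R, forall z, inD z -> Cmod (g z) * mu z <= K * assoc_weight nu z.

(* Main.v *)
Require Import Defs.
From Stdlib Require Import Reals Lra Lia ClassicalEpsilon.
From Coquelicot Require Import Coquelicot.
Open Scope R_scope.

(** Since [(S_g f)' = f' g] and [S_g f] vanishes at 0, boundedness on the Bloch
    spaces says that multiplication by [g] maps the derivatives, i.e. the
    functions of [H^infty_nu], boundedly into [H^infty_mu]; taking the supremum
    over the unit ball at a fixed point gives the condition on the associated
    weight [nu~].  For the little spaces, testing on the dilations
    [h_rho(z) = h(rho z)] of a function [h] of the unit ball and letting
    [rho -> 1] gives the same condition; conversely [nu |h - h_rho| -> 0]
    uniformly when [nu |h| -> 0] at the boundary, so [nu~ |h - h_rho|] is small
    too, while [nu~ |h_rho| -> 0] because [h_rho] is bounded and [nu~] is typical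
    (test on [z^n]).

    Holomorphy means mere complex differentiability here, so that [f'] is
    holomorphic and has primitives must be derived from Goursat's theorem, proved
    for straight-line homotopies [c0 + s (c1 - c0)] by bisecting the parameter
    square.  Contracting a curve to 0 gives primitives; deforming a centred
    circle to a small circle around [a] gives Cauchy's formula. *)

(** * Complex derivatives and derivatives of paths *)

Definition CRint (f : R -> C) (a b : R) : C :=
  RInt (V := C_R_CompleteNormedModule) f a b.

(** The remainder form: [<=] avoids excluding [w = z], and stating it with [Cmod] commits to no
    normed-module structure on [C]. *)
Definition cderiv (f : C -> C) (z l : C) : Prop :=
  forall eps, 0 < eps -> exists d, 0 < d /\ forall w, Cmod (w - z) < d ->
    Cmod (f w - f z - l * (w - z)) <= eps * Cmod (w - z).

(* Coquelicot has two incompatible normed-module structures on C over itself. *)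
Lemma cderiv_is_derive_both f z l :
  (cderiv f z l <-> is_derive (K := C_AbsRing) (V := C_NormedModule) f z l) /\
  (cderiv f z l <->
   is_derive (K := C_AbsRing) (V := AbsRing_NormedModule C_AbsRing) f z l).
Proof.
split; split.
- intros H; split; [apply is_linear_scal_l|].
  intros x Hx eps.
  rewrite <- (is_filter_lim_locally_unique (V := AbsRing_NormedModule C_AbsRing) z x Hx).
  destruct (H eps (cond_pos eps)) as [d [Hd H']].
  exists (mkposreal d Hd); intros w Hw.
  change (Cmod (w - z) < d) in Hw.
  specialize (H' w Hw).
  change (Cmod (f w - f z - (w - z) * l) <= eps * Cmod (w - z)).
  rewrite (Cmult_comm (w - z) l); exact H'.
- intros [_ H] eps Heps.
  destruct (H z (fun P HP => HP) (mkposreal eps Heps)) as [d Hd].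
  exists d; split; [apply cond_pos|]; intros w Hw.
  specialize (Hd w Hw).
  change (Cmod (f w - f z - (w - z) * l) <= eps * Cmod (w - z)) in Hd.
  rewrite (Cmult_comm (w - z) l) in Hd; exact Hd.
- intros H; split; [apply is_linear_scal_l|].
  intros x Hx eps.
  rewrite <- (is_filter_lim_locally_unique (V := AbsRing_NormedModule C_AbsRing) z x Hx).
  destruct (H eps (cond_pos eps)) as [d [Hd H']].
  exists (mkposreal d Hd); intros w Hw.
  change (Cmod (w - z) < d) in Hw.
  specialize (H' w Hw).
  change (Cmod (f w - f z - (w - z) * l) <= eps * Cmod (w - z)).
  rewrite (Cmult_comm (w - z) l); exact H'.
- intros [_ H] eps Heps.
  destruct (H z (fun P HP => HP) (mkposreal eps Heps)) as [d Hd].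
  exists d; split; [apply cond_pos|]; intros w Hw.
  specialize (Hd w Hw).
  change (Cmod (f w - f z - (w - z) * l) <= eps * Cmod (w - z)) in Hd.
  rewrite (Cmult_comm (w - z) l) in Hd; exact Hd.
Qed.

Lemma cderiv_is_derive f z l :
  cderiv f z l <-> is_derive (K := C_AbsRing) (V := C_NormedModule) f z l.
Proof. exact (proj1 (cderiv_is_derive_both f z l)). Qed.

Lemma cderiv_is_derive_ring f z l : cderiv f z l <->
  is_derive (K := C_AbsRing) (V := AbsRing_NormedModule C_AbsRing) f z l.
Proof. exact (proj2 (cderiv_is_derive_both f z l)). Qed.

(** Two-sided in [u], also at the ends of a parameter interval: paths are differentiable as
    functions on a neighbourhood of each parameter. *)
Definition pderiv (c : R -> C) (t : R) (l : C) : Prop :=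
  forall eps, 0 < eps -> exists d, 0 < d /\ forall u, Rabs (u - t) < d ->
    Cmod (c u - c t - l * RtoC (u - t)) <= eps * Rabs (u - t).

Lemma scal_C_R (x : R) (z : C) :
  scal (K := R_AbsRing) (V := C_R_NormedModule) x z = Cmult (RtoC x) z.
Proof.
destruct z as [a b]; unfold scal; simpl; unfold prod_scal, scal; simpl.
unfold mult, Cmult, RtoC; simpl; f_equal; ring.
Qed.

Lemma pderiv_is_derive c t l :
  pderiv c t l <-> is_derive (K := R_AbsRing) (V := C_R_NormedModule) c t l.
Proof.
split.
- intros H; split; [apply is_linear_scal_l|].
  intros x Hx eps.
  rewrite <- (is_filter_lim_locally_unique (V := AbsRing_NormedModule R_AbsRing) t x Hx).
  destruct (H eps (cond_pos eps)) as [d [Hd H']].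
  exists (mkposreal d Hd); intros w Hw.
  change (Rabs (w - t) < d) in Hw.
  specialize (H' w Hw).
  rewrite <- Cmod_norm, scal_C_R.
  change (Cmod (c w - c t - RtoC (w - t) * l) <= eps * Rabs (w - t)).
  rewrite (Cmult_comm _ l); exact H'.
- intros [_ H] eps Heps.
  destruct (H t (fun P HP => HP) (mkposreal eps Heps)) as [d Hd].
  exists d; split; [apply cond_pos|]; intros w Hw.
  specialize (Hd w Hw).
  rewrite <- Cmod_norm, scal_C_R in Hd.
  change (Cmod (c w - c t - RtoC (w - t) * l) <= eps * Rabs (w - t)) in Hd.
  rewrite (Cmult_comm _ l) in Hd; exact Hd.
Qed.

Lemma continuous_C {T : UniformSpace} (f : T -> C) x :
  continuous (U := C_UniformSpace) f x <->
  (forall eps, 0 < eps -> locally x (fun y => Cmod (f y - f x) < eps)).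
Proof.
split.
- intros H eps Heps.
  (* Balls of [C_UniformSpace] are sup-norm squares; passing to [Cmod] costs a factor [sqrt 2]. *)
  assert (He : 0 < eps / sqrt 2).
  { apply Rdiv_lt_0_compat; [|apply sqrt_lt_R0]; lra. }
  apply filter_imp with (2 := proj1 (filterlim_locally _ _) H (mkposreal _ He)).
  intros y Hy.
  assert (H2 := C_NormedModule_mixin_compat2 _ _ _ Hy).
  change (Cmod (f y - f x) < sqrt 2 * (eps / sqrt 2)) in H2.
  replace (sqrt 2 * (eps / sqrt 2)) with eps in H2; [exact H2|].
  field; apply Rgt_not_eq, sqrt_lt_R0; lra.
- intros H; apply filterlim_locally; intros eps.
  apply filter_imp with (2 := H eps (cond_pos eps)).
  intros y Hy; apply C_NormedModule_mixin_compat1; exact Hy.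
Qed.

Lemma continuous_C_loc (f : C -> C) x :
  continuous (T := C_UniformSpace) (U := C_UniformSpace) f x <->
  (forall eps, 0 < eps -> exists d, 0 < d /\
     forall y, Cmod (y - x) < d -> Cmod (f y - f x) < eps).
Proof.
rewrite continuous_C; split; intros H eps Heps.
- destruct (proj1 (locally_C _ _) (H eps Heps)) as [d Hd]; exists d; split; [apply cond_pos|exact Hd].
- destruct (H eps Heps) as [d [Hd H']].
  apply locally_C; exists (mkposreal d Hd); exact H'.
Qed.

Lemma cderiv_bound f z l : cderiv f z l -> exists d, 0 < d /\
  forall w, Cmod (w - z) < d -> Cmod (f w - f z) <= (Cmod l + 1) * Cmod (w - z).
Proof.
intros H; destruct (H 1 Rlt_0_1) as [d [Hd H']]; exists d; split; [exact Hd|].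
intros w Hw; specialize (H' w Hw).
replace (f w - f z)%C with ((f w - f z - l * (w - z)) + l * (w - z))%C by ring.
eapply Rle_trans; [apply Cmod_triangle|].
rewrite Cmod_mult; lra.
Qed.

Lemma cderiv_continuous f z l : cderiv f z l ->
  continuous (T := C_UniformSpace) (U := C_UniformSpace) f z.
Proof.
intros H; apply continuous_C_loc; intros eps Heps.
destruct (cderiv_bound f z l H) as [d [Hd H']].
assert (Hl := Cmod_ge_0 l).
exists (Rmin d (eps / (Cmod l + 1))); split.
- apply Rmin_glb_lt; [exact Hd|apply Rdiv_lt_0_compat; lra].
- intros y Hy.
  assert (Hy1 := Rlt_le_trans _ _ _ Hy (Rmin_l _ _)).
  assert (Hy2 := Rlt_le_trans _ _ _ Hy (Rmin_r _ _)).
  eapply Rle_lt_trans; [apply H'; exact Hy1|].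
  apply (Rmult_lt_compat_l (Cmod l + 1)) in Hy2; [|lra].
  replace ((Cmod l + 1) * (eps / (Cmod l + 1))) with eps in Hy2 by (field; lra).
  exact Hy2.
Qed.

Lemma continuous_pair {T : UniformSpace} (f g : T -> R) x :
  continuous f x -> continuous g x ->
  continuous (U := C_UniformSpace) (fun y => (f y, g y) : C) x.
Proof.
intros Hf Hg; apply filterlim_locally; intros eps.
apply filter_and; [apply (Hf (ball (f x) eps))|apply (Hg (ball (g x) eps))];
  apply locally_ball.
Qed.

Lemma continuous_Cmult {T : UniformSpace} (f g : T -> C) x :
  continuous (U := C_UniformSpace) f x -> continuous (U := C_UniformSpace) g x ->
  continuous (U := C_UniformSpace) (fun y => f y * g y)%C x.
Proof.
intros Hf Hg.
assert (Hf1 : continuous (fun y => fst (f y)) x)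
  by (apply (continuous_comp f fst); [exact Hf|apply continuous_fst]).
assert (Hf2 : continuous (fun y => snd (f y)) x)
  by (apply (continuous_comp f snd); [exact Hf|apply continuous_snd]).
assert (Hg1 : continuous (fun y => fst (g y)) x)
  by (apply (continuous_comp g fst); [exact Hg|apply continuous_fst]).
assert (Hg2 : continuous (fun y => snd (g y)) x)
  by (apply (continuous_comp g snd); [exact Hg|apply continuous_snd]).
apply continuous_pair.
- apply (continuous_minus (K := R_AbsRing) (V := R_NormedModule));
    apply (continuous_mult (K := R_AbsRing)); assumption.
- apply (continuous_plus (K := R_AbsRing) (V := R_NormedModule));
    apply (continuous_mult (K := R_AbsRing)); assumption.
Qed.

Lemma continuous_Cplus {T : UniformSpace} (f g : T -> C) x :
  continuous (U := C_UniformSpace) f x -> continuous (U := C_UniformSpace) g x ->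
  continuous (U := C_UniformSpace) (fun y => f y + g y)%C x.
Proof. apply (continuous_plus (K := R_AbsRing) (V := C_R_NormedModule)). Qed.

Lemma pderiv_continuous c t l : pderiv c t l ->
  continuous (U := C_UniformSpace) c t.
Proof.
intros H; apply pderiv_is_derive in H.
apply (ex_derive_continuous (K := R_AbsRing) (V := C_R_NormedModule)).
exists l; exact H.
Qed.

Lemma pderiv_comp f c t l m :
  cderiv f (c t) l -> pderiv c t m -> pderiv (fun u => f (c u)) t (l * m)%C.
Proof.
intros Hf Hc eps Heps.
assert (Hl := Cmod_ge_0 l); assert (Hm := Cmod_ge_0 m).
assert (He1 : 0 < eps / (2 * (Cmod m + 1))) by (apply Rdiv_lt_0_compat; lra).
destruct (Hf _ He1) as [d1 [Hd1 H1]].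
(* [e2 <= 1] gives [c] the Lipschitz constant [Cmod m + 1] near [t], so the remainder of [f] costs
   at most [eps / 2]; the other bound makes [l] times the remainder of [c] cost at most [eps / 2],
   both relative to [Rabs (u - t)]. *)
set (e2 := Rmin 1 (eps / (2 * (Cmod l + 1)))).
assert (He2 : 0 < e2) by (apply Rmin_glb_lt; [lra|apply Rdiv_lt_0_compat; lra]).
destruct (Hc e2 He2) as [d2 [Hd2 H2]].
exists (Rmin d2 (d1 / (Cmod m + 1))); split.
{ apply Rmin_glb_lt; [exact Hd2|apply Rdiv_lt_0_compat; lra]. }
intros u Hu.
assert (Hu1 := Rlt_le_trans _ _ _ Hu (Rmin_l _ _)).
assert (Hu2 := Rlt_le_trans _ _ _ Hu (Rmin_r _ _)).
specialize (H2 u Hu1).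
assert (Hau := Rabs_pos (u - t)).
assert (He2a : e2 <= 1) by apply Rmin_l.
assert (He2b : e2 * (Cmod l + 1) <= eps / 2).
{ apply Rle_trans with (eps / (2 * (Cmod l + 1)) * (Cmod l + 1)).
  - apply Rmult_le_compat_r; [lra|apply Rmin_r].
  - right; field; lra. }
assert (H3 : Cmod (c u - c t) <= (Cmod m + 1) * Rabs (u - t)).
{ replace (c u - c t)%C with ((c u - c t - m * RtoC (u - t)) + m * RtoC (u - t))%C by ring.
  eapply Rle_trans; [apply Cmod_triangle|].
  rewrite Cmod_mult, Cmod_R; nra. }
assert (H4 : Cmod (c u - c t) < d1).
{ apply (Rmult_lt_compat_l (Cmod m + 1)) in Hu2; [|lra].
  replace ((Cmod m + 1) * (d1 / (Cmod m + 1))) with d1 in Hu2 by (field; lra).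
  lra. }
specialize (H1 _ H4).
replace (f (c u) - f (c t) - l * m * RtoC (u - t))%C with
  ((f (c u) - f (c t) - l * (c u - c t)) + l * (c u - c t - m * RtoC (u - t)))%C by ring.
eapply Rle_trans; [apply Cmod_triangle|].
rewrite Cmod_mult.
assert (H5 : eps / (2 * (Cmod m + 1)) * Cmod (c u - c t) <= eps / 2 * Rabs (u - t)).
{ apply Rle_trans with (eps / (2 * (Cmod m + 1)) * ((Cmod m + 1) * Rabs (u - t))).
  - apply Rmult_le_compat_l; lra.
  - right; field; lra. }
assert (H6 : Cmod l * Cmod (c u - c t - m * RtoC (u - t)) <= (Cmod l + 1) * e2 * Rabs (u - t)).
{ rewrite Rmult_assoc; apply Rmult_le_compat; try lra; try apply Cmod_ge_0. }
nra.
Qed.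

Lemma cderiv_ext_loc f g z l r : 0 < r ->
  (forall w, Cmod (w - z) < r -> f w = g w) -> cderiv f z l -> cderiv g z l.
Proof.
intros Hr E H eps Heps; destruct (H eps Heps) as [d [Hd H']].
exists (Rmin d r); split; [apply Rmin_glb_lt; assumption|].
intros w Hw.
rewrite <- (E w), <- (E z).
- apply H'; eapply Rlt_le_trans; [exact Hw|apply Rmin_l].
- replace (z - z)%C with (RtoC 0) by ring; rewrite Cmod_0; exact Hr.
- eapply Rlt_le_trans; [exact Hw|apply Rmin_r].
Qed.

Lemma cderiv_unique f z l m : cderiv f z l -> cderiv f z m -> l = m.
Proof.
intros H1 H2; apply cderiv_is_derive in H1, H2.
rewrite <- (is_C_derive_unique _ _ _ H1); apply is_C_derive_unique, H2.
Qed.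

Lemma cderiv_const a z : cderiv (fun _ => a) z 0.
Proof.
intros eps Heps; exists 1; split; [lra|]; intros w _.
replace (a - a - 0 * (w - z))%C with (RtoC 0) by ring; rewrite Cmod_0.
apply Rmult_le_pos; [lra|apply Cmod_ge_0].
Qed.

Lemma cderiv_id z : cderiv (fun w => w) z 1.
Proof.
intros eps Heps; exists 1; split; [lra|]; intros w _.
replace (w - z - 1 * (w - z))%C with (RtoC 0) by ring; rewrite Cmod_0.
apply Rmult_le_pos; [lra|apply Cmod_ge_0].
Qed.

Lemma cderiv_plus f g z l m : cderiv f z l -> cderiv g z m ->
  cderiv (fun w => f w + g w)%C z (l + m)%C.
Proof.
intros H1 H2; apply cderiv_is_derive; apply cderiv_is_derive in H1, H2.
apply (is_derive_plus (K := C_AbsRing) (V := C_NormedModule)); assumption.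
Qed.

Lemma cderiv_mult f g z l m : cderiv f z l -> cderiv g z m ->
  cderiv (fun w => f w * g w)%C z (l * g z + f z * m)%C.
Proof.
intros H1 H2; apply cderiv_is_derive_ring; apply cderiv_is_derive_ring in H1, H2.
apply (is_derive_mult (K := C_AbsRing) f g z l m); [exact H1|exact H2|].
intros; apply Cmult_comm.
Qed.

Lemma cderiv_comp f g z l m : cderiv f (g z) l -> cderiv g z m ->
  cderiv (fun w => f (g w)) z (l * m)%C.
Proof.
intros H1 H2; apply cderiv_is_derive; apply cderiv_is_derive in H1; apply cderiv_is_derive_ring in H2.
rewrite Cmult_comm.
apply (is_derive_comp (K := C_AbsRing) (V := C_NormedModule) f g z l m);
  [exact H1|exact H2].
Qed.

(** * Path integrals and bisection *)

Definition Ccont_on (f : R -> C) (a b : R) : Prop :=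
  forall t, a <= t <= b -> continuous (U := C_UniformSpace) f t.

Lemma is_CRint f a b : a <= b -> Ccont_on f a b ->
  is_RInt (V := C_R_NormedModule) f a b (CRint f a b).
Proof.
intros Hab H; apply (RInt_correct (V := C_R_CompleteNormedModule)).
apply (ex_RInt_continuous (V := C_R_CompleteNormedModule)).
rewrite Rmin_left, Rmax_right by exact Hab; exact H.
Qed.

Lemma CRint_bound f a b M : a <= b -> Ccont_on f a b ->
  (forall t, a <= t <= b -> Cmod (f t) <= M) -> Cmod (CRint f a b) <= (b - a) * M.
Proof.
intros Hab Hf HM; rewrite Cmod_norm.
apply (norm_RInt_le_const (V := C_R_NormedModule) f a b); [exact Hab| |apply is_CRint; assumption].
intros t Ht; rewrite <- Cmod_norm; apply HM, Ht.
Qed.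

Lemma CRint_FTC F f a b : a <= b -> Ccont_on f a b ->
  (forall t, a <= t <= b -> pderiv F t (f t)) -> CRint f a b = (F b - F a)%C.
Proof.
intros Hab Hf HF.
apply (is_RInt_unique (V := C_R_CompleteNormedModule)).
apply (is_RInt_derive (V := C_R_CompleteNormedModule) F f a b);
  rewrite Rmin_left, Rmax_right by exact Hab.
- intros t Ht; apply pderiv_is_derive, HF, Ht.
- exact Hf.
Qed.

Lemma CRint_minus f g a b : a <= b -> Ccont_on f a b -> Ccont_on g a b ->
  CRint (fun t => f t - g t)%C a b = (CRint f a b - CRint g a b)%C.
Proof.
intros Hab Hf Hg; apply (is_RInt_unique (V := C_R_CompleteNormedModule)).
apply (is_RInt_minus (V := C_R_NormedModule)); apply is_CRint; assumption.
Qed.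

Lemma CRint_scal k f a b : a <= b -> Ccont_on f a b ->
  CRint (fun t => k * f t)%C a b = (k * CRint f a b)%C.
Proof.
intros Hab Hf; apply (is_RInt_unique (V := C_R_CompleteNormedModule)).
assert (H := is_CRint f a b Hab Hf).
(* The integral is taken in a real vector space, so a complex factor is handled through real and
   imaginary parts. *)
assert (H1 := is_RInt_fct_extend_fst f a b _ H).
assert (H2 := is_RInt_fct_extend_snd f a b _ H).
apply is_RInt_fct_extend_pair.
- apply (is_RInt_minus (V := R_NormedModule)); apply (is_RInt_scal (V := R_NormedModule)); assumption.
- apply (is_RInt_plus (V := R_NormedModule)); apply (is_RInt_scal (V := R_NormedModule)); assumption.
Qed.

Lemma CRint_ext f g a b : a <= b -> (forall t, a <= t <= b -> f t = g t) ->
  CRint f a b = CRint g a b.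
Proof.
intros Hab H; apply (RInt_ext (V := C_R_CompleteNormedModule)); intros t Ht.
rewrite Rmin_left, Rmax_right in Ht by exact Hab; apply H; lra.
Qed.

Lemma CRint_Chasles f a b c : a <= b <= c -> Ccont_on f a c ->
  CRint f a c = (CRint f a b + CRint f b c)%C.
Proof.
intros Hab Hf; symmetry; apply (RInt_Chasles (V := C_R_CompleteNormedModule));
  eexists; apply is_CRint; try lra; intros t Ht; apply Hf; lra.
Qed.

(** The supremum of the left endpoints works, because every left endpoint lies below every right
    endpoint. *)
Lemma nested_intervals (s d : nat -> R) : (forall n, 0 <= d n) ->
  (forall n, s n <= s (S n)) -> (forall n, s (S n) + d (S n) <= s n + d n) ->
  exists p, forall n, s n <= p <= s n + d n.
Proof.
intros Hd Hs Hsd.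
assert (Hinc : forall n k, s n <= s (n + k)%nat).
{ intros n k; induction k as [|k IH]; [rewrite Nat.add_0_r; lra|].
  rewrite Nat.add_succ_r; specialize (Hs (n + k)%nat); lra. }
assert (Hdec : forall n k, s (n + k)%nat + d (n + k)%nat <= s n + d n).
{ intros n k; induction k as [|k IH]; [rewrite Nat.add_0_r; lra|].
  rewrite Nat.add_succ_r; specialize (Hsd (n + k)%nat); lra. }
assert (Hub : forall n m, s m <= s n + d n).
{ intros n m; destruct (Nat.le_ge_cases n m) as [H|H].
  - replace m with (n + (m - n))%nat by lia.
    specialize (Hdec n (m - n)%nat); specialize (Hd (n + (m - n))%nat); lra.
  - specialize (Hinc m (n - m)%nat); specialize (Hd n).
    replace (m + (n - m))%nat with n in Hinc by lia; lra. }
destruct (completeness (fun x => exists n, x = s n)) as [p [H1 H2]].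
- exists (s 0%nat + d 0%nat); intros x [n ->]; apply Hub.
- exists (s 0%nat), 0%nat; reflexivity.
- exists p; intros n; split; [apply H1; exists n; reflexivity|].
  apply H2; intros x [m ->]; apply Hub.
Qed.

Definition subsquare (s t d : R) : Prop :=
  0 < d /\ 0 <= s /\ s + d <= 1 /\ 0 <= t /\ t + d <= 1.

(** If [I 0 0 1] had modulus [e > 0], some quarter of each bad square would keep the ratio
    [Cmod (I s t d) >= e * d ^ 2]. The nested bad squares shrink to a point, where the local
    estimate with [e / 2] contradicts this ratio. *)
Lemma bisection (I : R -> R -> R -> C) :
  (forall s t d, subsquare s t d -> I s t d =
     Cplus (Cplus (Cplus (I s t (d / 2)) (I (s + d / 2) t (d / 2)))
       (I s (t + d / 2) (d / 2))) (I (s + d / 2) (t + d / 2) (d / 2))) ->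
  (forall p q eps, 0 <= p <= 1 -> 0 <= q <= 1 -> 0 < eps ->
     exists delta, 0 < delta /\ forall s t d, subsquare s t d ->
       s <= p <= s + d -> t <= q <= t + d -> d < delta ->
       Cmod (I s t d) <= eps * d ^ 2) ->
  I 0 0 1 = RtoC 0.
Proof.
intros Hadd Hloc; apply Cmod_eq_0.
set (e := Cmod (I 0 0 1)).
destruct (Rle_lt_or_eq_dec 0 e (Cmod_ge_0 _)) as [He|He]; [exfalso|auto].
set (bad := fun (u : R * R) d => subsquare (fst u) (snd u) d /\
  e * d ^ 2 <= Cmod (I (fst u) (snd u) d)).
assert (Hstep : forall u d, bad u d -> exists v, bad v (d / 2) /\
  fst u <= fst v <= fst u + d / 2 /\ snd u <= snd v <= snd u + d / 2).
{ intros [s t] d [Hsq Hb]; simpl in Hsq, Hb.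
  rewrite (Hadd s t d Hsq) in Hb.
  unfold subsquare in Hsq.
  assert (T := Cmod_triangle (Cplus (Cplus (I s t (d / 2)) (I (s + d / 2) t (d / 2)))
      (I s (t + d / 2) (d / 2))) (I (s + d / 2) (t + d / 2) (d / 2))).
  assert (T' := Cmod_triangle (Cplus (I s t (d / 2)) (I (s + d / 2) t (d / 2)))
      (I s (t + d / 2) (d / 2))).
  assert (T'' := Cmod_triangle (I s t (d / 2)) (I (s + d / 2) t (d / 2))).
  replace (e * d ^ 2) with (4 * (e * (d / 2) ^ 2)) in Hb by field.
  destruct (Rle_lt_dec (e * (d / 2) ^ 2) (Cmod (I s t (d / 2)))) as [H1|H1].
  { exists (s, t); unfold bad, subsquare; simpl; repeat split; try lra; exact H1. }
  destruct (Rle_lt_dec (e * (d / 2) ^ 2) (Cmod (I (s + d / 2) t (d / 2)))) as [H2|H2].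
  { exists (s + d / 2, t); unfold bad, subsquare; simpl; repeat split; try lra; exact H2. }
  destruct (Rle_lt_dec (e * (d / 2) ^ 2) (Cmod (I s (t + d / 2) (d / 2)))) as [H3|H3].
  { exists (s, t + d / 2); unfold bad, subsquare; simpl; repeat split; try lra; exact H3. }
  (* The four moduli sum to at least four times the threshold and three lie strictly below it, so
     the last quarter is bad. *)
  exists (s + d / 2, t + d / 2); unfold bad, subsquare; cbn [fst snd].
  repeat split; lra. }
(* Choosing the bad quarter by a function allows the sequence of corners to be defined by plain
   recursion. *)
set (next := fun u d => epsilon (inhabits (0, 0)) (fun v => bad v (d / 2) /\
  fst u <= fst v <= fst u + d / 2 /\ snd u <= snd v <= snd u + d / 2)).
assert (Hnext : forall u d, bad u d -> bad (next u d) (d / 2) /\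
  fst u <= fst (next u d) <= fst u + d / 2 /\
  snd u <= snd (next u d) <= snd u + d / 2).
{ intros u d Hb; apply (epsilon_spec (inhabits (0, 0)) _ (Hstep u d Hb)). }
set (sq := fix sq n : R * R :=
  match n with O => (0, 0) | S m => next (sq m) ((/ 2) ^ m) end).
assert (Hpow : forall n, (/ 2) ^ S n = (/ 2) ^ n / 2) by (intros n; simpl; field).
assert (Hpos : forall n, 0 < (/ 2) ^ n) by (intros n; apply pow_lt; lra).
assert (Hbad : forall n, bad (sq n) ((/ 2) ^ n)).
{ induction n as [|n IH].
  - unfold bad, subsquare; simpl; repeat split; try lra.
    fold e; lra.
  - rewrite Hpow; apply (Hnext _ _ IH). }
destruct (nested_intervals (fun n => fst (sq n)) (fun n => (/ 2) ^ n)) as [p Hp].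
{ intros n; apply Rlt_le, Hpos. }
{ intros n; apply (Hnext _ _ (Hbad n)). }
{ intros n; rewrite Hpow; generalize (Hnext _ _ (Hbad n)); simpl; lra. }
destruct (nested_intervals (fun n => snd (sq n)) (fun n => (/ 2) ^ n)) as [q Hq].
{ intros n; apply Rlt_le, Hpos. }
{ intros n; apply (Hnext _ _ (Hbad n)). }
{ intros n; rewrite Hpow; generalize (Hnext _ _ (Hbad n)); simpl; lra. }
destruct (Hloc p q (e / 2)) as [delta [Hdelta Hl]].
{ generalize (Hp 0%nat); simpl; lra. }
{ generalize (Hq 0%nat); simpl; lra. }
{ lra. }
destruct (pow_lt_1_zero (/ 2) (Rabs_def1 (/2) 1 ltac:(lra) ltac:(lra)) delta Hdelta) as [N HN].
specialize (HN N (Nat.le_refl _)).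
rewrite Rabs_pos_eq in HN by apply Rlt_le, Hpos.
destruct (Hbad N) as [Hsq Hge].
specialize (Hl _ _ _ Hsq (Hp N) (Hq N) HN).
assert (0 < ((/ 2) ^ N) ^ 2) by (apply pow_lt, Hpos).
nra.
Qed.

(* [P] is a primitive of the affine part of [f] at [z0]: its increments cancel around
   a closed curve, so only the remainder [m] contributes there. *)
Lemma edge_estimate f z0 l c c' a b m L : a <= b -> 0 <= m ->
  (forall u, a <= u <= b -> pderiv c u (c' u)) -> Ccont_on c' a b ->
  (forall u, a <= u <= b -> exists k, cderiv f (c u) k) ->
  (forall u, a <= u <= b -> Cmod (f (c u) - f z0 - l * (c u - z0)) <= m) ->
  (forall u, a <= u <= b -> Cmod (c' u) <= L) ->
  let P := fun w => (f z0 * w + l / 2 * ((w - z0) * (w - z0)))%C in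
  Cmod (CRint (fun u => f (c u) * c' u)%C a b - (P (c b) - P (c a))) <=
  (b - a) * (m * L).
Proof.
intros Hab Hm Hc Hc' Hf Hfm HL P.
assert (Hcc : Ccont_on c a b) by (intros u Hu; apply (pderiv_continuous c u _ (Hc u Hu))).
(* [P] is quadratic with leading coefficient [l / 2], so its remainder is exactly
   [l / 2 * (v - w) * (v - w)]. *)
assert (HP : forall w, cderiv P w (f z0 + l * (w - z0))%C).
{ intros w eps Heps.
  assert (Hl := Cmod_ge_0 (l / 2)).
  exists (eps / (Cmod (l / 2) + 1)); split; [apply Rdiv_lt_0_compat; lra|].
  intros v Hv; unfold P.
  replace (f z0 * v + l / 2 * ((v - z0) * (v - z0)) -
     (f z0 * w + l / 2 * ((w - z0) * (w - z0))) -
     (f z0 + l * (w - z0)) * (v - w))%C with (l / 2 * (v - w) * (v - w))%C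
     by (field; intros E; injection E; lra).
  rewrite !Cmod_mult; apply Rmult_le_compat_r; [apply Cmod_ge_0|].
  apply (Rmult_lt_compat_l (Cmod (l / 2) + 1)) in Hv; [|lra].
  replace ((Cmod (l / 2) + 1) * (eps / (Cmod (l / 2) + 1))) with eps in Hv by (field; lra).
  generalize (Cmod_ge_0 (v - w)); nra. }
assert (Hlin : Ccont_on (fun u => (f z0 + l * (c u - z0)) * c' u)%C a b).
{ intros u Hu; apply continuous_Cmult; [|apply Hc', Hu].
  apply continuous_Cplus; [apply continuous_const|].
  apply continuous_Cmult; [apply continuous_const|].
  apply continuous_Cplus; [apply Hcc, Hu|apply continuous_const]. }
assert (Hfc : Ccont_on (fun u => f (c u) * c' u)%C a b).
{ intros u Hu; apply continuous_Cmult; [|apply Hc', Hu].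
  destruct (Hf u Hu) as [k Hk].
  apply (continuous_comp (V := C_UniformSpace) c f); [apply Hcc, Hu|].
  apply (cderiv_continuous f _ k Hk). }
rewrite <- (CRint_FTC (fun u => P (c u)) (fun u => (f z0 + l * (c u - z0)) * c' u)%C);
  [|exact Hab|exact Hlin|].
2:{ intros u Hu; apply pderiv_comp; [apply HP|apply Hc, Hu]. }
rewrite <- CRint_minus by assumption.
apply CRint_bound; [exact Hab| |].
- intros u Hu; apply (continuous_minus (K := R_AbsRing) (V := C_R_NormedModule));
    [apply Hfc, Hu|apply Hlin, Hu].
- intros u Hu.
  replace (f (c u) * c' u - (f z0 + l * (c u - z0)) * c' u)%C
    with ((f (c u) - f z0 - l * (c u - z0)) * c' u)%C by ring.
  rewrite Cmod_mult; apply Rmult_le_compat; try apply Cmod_ge_0; auto.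
Qed.

Lemma pderiv_affine a b s : pderiv (fun s => a + RtoC s * b)%C s b.
Proof.
intros eps Heps; exists 1; split; [lra|]; intros u _.
replace (a + RtoC u * b - (a + RtoC s * b) - b * RtoC (u - s))%C with (RtoC 0)
  by (rewrite RtoC_minus; ring).
rewrite Cmod_0; apply Rmult_le_pos; [lra|apply Rabs_pos].
Qed.

Lemma pderiv_const a t : pderiv (fun _ => a) t 0.
Proof.
intros eps Heps; exists 1; split; [lra|]; intros u _.
replace (a - a - 0 * RtoC (u - t))%C with (RtoC 0) by ring.
rewrite Cmod_0; apply Rmult_le_pos; [lra|apply Rabs_pos].
Qed.

Lemma pderiv_plus c1 c2 t l1 l2 : pderiv c1 t l1 -> pderiv c2 t l2 ->
  pderiv (fun u => c1 u + c2 u)%C t (l1 + l2)%C.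
Proof.
intros H1 H2; apply pderiv_is_derive; apply pderiv_is_derive in H1, H2.
apply (is_derive_plus (K := R_AbsRing) (V := C_R_NormedModule)); assumption.
Qed.

Lemma pderiv_scal k c t l : pderiv c t l -> pderiv (fun u => k * c u)%C t (k * l)%C.
Proof.
intros H; apply (pderiv_comp (fun w => k * w)%C c t k l); [|exact H].
assert (Hm := cderiv_mult (fun _ => k) (fun w => w) (c t) _ _
  (cderiv_const k _) (cderiv_id _)).
cbv beta in Hm; replace (0 * c t + k * 1)%C with k in Hm by ring; exact Hm.
Qed.

Lemma CRint_const k : CRint (fun _ => k) 0 1 = k.
Proof.
rewrite (CRint_FTC (fun t => 0 + RtoC t * k)%C); [ring|lra| |].
- intros t _; apply continuous_const.
- intros t _; apply pderiv_affine.
Qed.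

(** * Goursat's theorem *)

(** The increment of [c] is the integral of [c'], which replaces the mean value theorem for complex
    values. *)
Lemma pderiv_lipschitz c c' L a b : a <= b ->
  Ccont_on c' a b -> (forall t, a <= t <= b -> pderiv c t (c' t)) ->
  (forall t, a <= t <= b -> Cmod (c' t) <= L) ->
  forall t u, a <= t <= b -> a <= u <= b -> Cmod (c u - c t) <= L * Rabs (u - t).
Proof.
intros Hab Hc' Hc HL.
assert (W : forall t u, a <= t <= u -> u <= b -> Cmod (c u - c t) <= L * Rabs (u - t)).
{ intros t u Ht Hu.
  rewrite <- (CRint_FTC c c' t u); [|lra|intros x Hx; apply Hc'; lra|intros x Hx; apply Hc; lra].
  rewrite Rabs_pos_eq, Rmult_comm by lra.
  apply CRint_bound; [lra|intros x Hx; apply Hc'; lra|intros x Hx; apply HL; lra]. }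
intros t u Ht Hu; destruct (Rle_lt_dec t u).
- apply W; lra.
- replace (c u - c t)%C with (- (c t - c u))%C by ring.
  rewrite Cmod_opp, Rabs_minus_sym; apply W; lra.
Qed.

(** The four integrals run around the image under [H] of the boundary of the parameter square. The
    edges traced by the endpoints of the curves are kept, so the curves need be neither closed nor
    share endpoints; [L] bounds both partial derivatives of [H]. *)
Lemma goursat_homotopy (f : C -> C) (c0 c1 c0' c1' : R -> C) (L : R) :
  let H := fun s t : R => (c0 t + RtoC s * (c1 t - c0 t))%C in
  Ccont_on c0' 0 1 -> Ccont_on c1' 0 1 ->
  (forall t, 0 <= t <= 1 -> pderiv c0 t (c0' t)) ->
  (forall t, 0 <= t <= 1 -> pderiv c1 t (c1' t)) ->
  (forall t, 0 <= t <= 1 -> Cmod (c0' t) <= L) ->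
  (forall t, 0 <= t <= 1 -> Cmod (c1' t) <= L) ->
  (forall t, 0 <= t <= 1 -> Cmod (c1 t - c0 t) <= L) ->
  (forall s t, 0 <= s <= 1 -> 0 <= t <= 1 -> exists l, cderiv f (H s t) l) ->
  (CRint (fun s => f (H s 0) * (c1 0 - c0 0)) 0 1 +
   CRint (fun t => f (c1 t) * c1' t) 0 1 -
   CRint (fun s => f (H s 1) * (c1 1 - c0 1)) 0 1 -
   CRint (fun t => f (c0 t) * c0' t) 0 1)%C = RtoC 0.
Proof.
intros H Hc0' Hc1' Hc0 Hc1 HL0 HL1 HL Hf.
set (Ht := fun s t : R => (c0' t + RtoC s * (c1' t - c0' t))%C).
assert (HHs : forall t s, pderiv (fun s => H s t) s (c1 t - c0 t)%C)
  by (intros t s; apply pderiv_affine).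
assert (HHt : forall s t, 0 <= t <= 1 -> pderiv (fun t => H s t) t (Ht s t)).
{ intros s t Hr; apply pderiv_plus; [apply Hc0, Hr|].
  apply pderiv_scal.
  replace (c1' t - c0' t)%C with (c1' t + (- (1)) * c0' t)%C by ring.
  assert (Hd := pderiv_plus c1 _ t _ _ (Hc1 t Hr) (pderiv_scal (- (1))%C c0 t _ (Hc0 t Hr))).
  intros eps Heps; destruct (Hd eps Heps) as [d [Hd0 Hd1]]; exists d; split; [exact Hd0|].
  intros u Hu; specialize (Hd1 u Hu); simpl in Hd1.
  replace (c1 u - c0 u - (c1 t - c0 t))%C
    with (c1 u + - (1) * c0 u - (c1 t + - (1) * c0 t))%C by ring.
  exact Hd1. }
assert (HHtc : forall s, Ccont_on (Ht s) 0 1).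
{ intros s t Hr; unfold Ht; apply continuous_Cplus; [apply Hc0', Hr|].
  apply continuous_Cmult; [apply continuous_const|].
  apply (continuous_minus (K := R_AbsRing) (V := C_R_NormedModule));
    [apply Hc1', Hr|apply Hc0', Hr]. }
assert (HL' : 0 <= L) by (apply Rle_trans with (2 := HL 0 ltac:(lra)); apply Cmod_ge_0).
(* [Ht s t] is a convex combination of [c0' t] and [c1' t]. *)
assert (HHtL : forall s t, 0 <= s <= 1 -> 0 <= t <= 1 -> Cmod (Ht s t) <= L).
{ intros s t Hs Hr; unfold Ht.
  replace (c0' t + RtoC s * (c1' t - c0' t))%C
    with (RtoC (1 - s) * c0' t + RtoC s * c1' t)%C by (rewrite RtoC_minus; ring).
  eapply Rle_trans; [apply Cmod_triangle|].
  rewrite !Cmod_mult, !Cmod_R, !Rabs_pos_eq by lra.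
  specialize (HL0 t Hr); specialize (HL1 t Hr); nra. }
assert (Hlip : forall s t p q, 0 <= s <= 1 -> 0 <= t <= 1 -> 0 <= q <= 1 ->
   Cmod (H s t - H p q) <= L * Rabs (s - p) + L * Rabs (t - q)).
{ intros s t p q Hs Hr Hq.
  replace (H s t - H p q)%C with ((H s t - H s q) + (c1 q - c0 q) * RtoC (s - p))%C
    by (unfold H; rewrite RtoC_minus; ring).
  eapply Rle_trans; [apply Cmod_triangle|].
  rewrite Cmod_mult, Cmod_R.
  assert (Cmod (H s t - H s q) <= L * Rabs (t - q)).
  { apply (pderiv_lipschitz (fun t => H s t) (Ht s) L 0 1); auto; lra. }
  assert (H5 := HL q Hq); generalize (Rabs_pos (s - p)); nra. }
assert (Hfs : forall t, 0 <= t <= 1 -> Ccont_on (fun s => f (H s t) * (c1 t - c0 t))%C 0 1).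
{ intros t Hr s Hs; apply continuous_Cmult; [|apply continuous_const].
  destruct (Hf s t Hs Hr) as [k Hk].
  apply (continuous_comp (V := C_UniformSpace) (fun s => H s t) f).
  - apply (pderiv_continuous _ _ _ (HHs t s)).
  - apply (cderiv_continuous f _ k Hk). }
assert (Hft : forall s, 0 <= s <= 1 -> Ccont_on (fun t => f (H s t) * Ht s t)%C 0 1).
{ intros s Hs t Hr; apply continuous_Cmult; [|apply HHtc, Hr].
  destruct (Hf s t Hs Hr) as [k Hk].
  apply (continuous_comp (V := C_UniformSpace) (fun t => H s t) f).
  - apply (pderiv_continuous _ _ _ (HHt s t Hr)).
  - apply (cderiv_continuous f _ k Hk). }
set (A := fun t s0 s1 : R => CRint (fun s => f (H s t) * (c1 t - c0 t))%C s0 s1).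
set (B := fun s t0 t1 : R => CRint (fun t => f (H s t) * Ht s t)%C t0 t1).
(* The boundary integral of the square with corner [(s, t)] and side [d]; it is additive under
   quartering because inner edges are run in both directions. *)
set (I := fun s t d : R =>
  (A t s (s + d)%R + B (s + d)%R t (t + d)%R - A (t + d)%R s (s + d)%R - B s t (t + d)%R)%C).
assert (HAC : forall t s d, 0 <= t <= 1 -> 0 < d -> 0 <= s -> s + d <= 1 ->
  A t s (s + d) = Cplus (A t s (s + d / 2)) (A t (s + d / 2) (s + d / 2 + d / 2))).
{ intros t s d Hr Hd H1 H2; unfold A.
  replace (s + d / 2 + d / 2) with (s + d) by field.
  apply CRint_Chasles; [lra|]; intros x Hx; apply Hfs; lra. }
assert (HBC : forall s t d, 0 <= s <= 1 -> 0 < d -> 0 <= t -> t + d <= 1 ->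
  B s t (t + d) = Cplus (B s t (t + d / 2)) (B s (t + d / 2) (t + d / 2 + d / 2))).
{ intros s t d Hr Hd H1 H2; unfold B.
  replace (t + d / 2 + d / 2) with (t + d) by field.
  apply CRint_Chasles; [lra|]; intros x Hx; apply Hft; lra. }
assert (HI : I 0 0 1 = RtoC 0).
{ apply bisection.
  - intros s t d (Hd & Hs & Hsd & Hr & Htd); unfold I.
    rewrite (HAC t s d), (HBC (s + d) t d), (HAC (t + d) s d), (HBC s t d) by lra.
    replace (s + d / 2 + d / 2) with (s + d) by field.
    replace (t + d / 2 + d / 2) with (t + d) by field.
    ring.
  - intros p q eps Hp Hq Heps.
    destruct (Hf p q Hp Hq) as [l Hl].
    (* Each of the four edges will contribute at most [d * (m * L)] with [m = e * (2 * L * d)], in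
       total [8 * e * L ^ 2 * d ^ 2]. Using [L + 1] avoids dividing by zero. *)
    set (e := eps / (8 * (L + 1) * (L + 1))).
    assert (He : 0 < e) by (apply Rdiv_lt_0_compat; nra).
    destruct (Hl e He) as [d0 [Hd0 Hl']].
    (* The image of a subsquare containing [(p, q)] stays within [2 * L * d] of [H p q], hence
       inside the radius [d0]. *)
    exists (d0 / (2 * (L + 1))); split; [apply Rdiv_lt_0_compat; lra|].
    intros s t d (Hd & Hs & Hsd & Hr & Htd) Hps Hqt Hdd.
    assert (Hdd' : 2 * (L + 1) * d < d0).
    { apply (Rmult_lt_compat_l (2 * (L + 1))) in Hdd; [|lra].
      replace (2 * (L + 1) * (d0 / (2 * (L + 1)))) with d0 in Hdd by (field; lra).
      exact Hdd. }
    assert (Hrem : forall x y, s <= x <= s + d -> t <= y <= t + d ->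
      Cmod (f (H x y) - f (H p q) - l * (H x y - H p q)) <= e * (2 * L * d)).
    { intros x y Hx Hy.
      assert (Hn : Cmod (H x y - H p q) <= 2 * L * d).
      { eapply Rle_trans; [apply Hlip; lra|].
        assert (Rabs (x - p) <= d) by (apply Rabs_le; lra).
        assert (Rabs (y - q) <= d) by (apply Rabs_le; lra). nra. }
      eapply Rle_trans; [apply Hl'; lra|].
      apply Rmult_le_compat_l; lra. }
    set (m := e * (2 * L * d)).
    assert (Hm : 0 <= m) by (unfold m; apply Rmult_le_pos; nra).
    set (P := fun w => (f (H p q) * w + l / 2 * ((w - H p q) * (w - H p q)))%C).
    assert (EA : forall y, t <= y <= t + d ->
      Cmod (A y s (s + d) - (P (H (s + d) y) - P (H s y))) <= d * (m * L)).
    { intros y Hy.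
      replace (d * (m * L)) with ((s + d - s) * (m * L)) by ring.
      apply (edge_estimate f (H p q) l (fun s => H s y) (fun _ => c1 y - c0 y)%C).
      - lra.
      - exact Hm.
      - intros u _; apply HHs.
      - intros u _; apply continuous_const.
      - intros u Hu; apply Hf; lra.
      - intros u Hu; apply Hrem; lra.
      - intros u Hu; apply HL; lra. }
    assert (EB : forall x, s <= x <= s + d ->
      Cmod (B x t (t + d) - (P (H x (t + d)) - P (H x t))) <= d * (m * L)).
    { intros x Hx.
      replace (d * (m * L)) with ((t + d - t) * (m * L)) by ring.
      apply (edge_estimate f (H p q) l (fun t => H x t) (Ht x)).
      - lra.
      - exact Hm.
      - intros u Hu; apply HHt; lra.
      - intros u Hu; apply HHtc; lra.
      - intros u Hu; apply Hf; lra.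
      - intros u Hu; apply Hrem; lra.
      - intros u Hu; apply HHtL; lra. }
    assert (E1 := EA t ltac:(lra)); assert (E2 := EA (t + d) ltac:(lra)).
    assert (E3 := EB s ltac:(lra)); assert (E4 := EB (s + d) ltac:(lra)).
    unfold I.
    revert E1 E2 E3 E4; clearbody P.
    generalize (A t s (s + d)) (A (t + d) s (s + d)) (B s t (t + d)) (B (s + d) t (t + d)).
    generalize (P (H (s + d) (t + d))) (P (H (s + d) t)) (P (H s (t + d))) (P (H s t)).
    intros P11 P10 P01 P00 A0 A1 B0 B1 E1 E2 E3 E4.
    (* The corner values of [P] telescope around the square, so they can be inserted for free. *)
    replace (A0 + B1 - A1 - B0)%C with
      ((A0 - (P10 - P00)) + (B1 - (P11 - P10)) + - (A1 - (P11 - P01)) + - (B0 - (P01 - P00)))%C by ring.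
    eapply Rle_trans; [apply Cmod_triangle|].
    eapply Rle_trans; [apply Rplus_le_compat_r, Cmod_triangle|].
    eapply Rle_trans; [apply Rplus_le_compat_r, Rplus_le_compat_r, Cmod_triangle|].
    rewrite !Cmod_opp.
    apply Rle_trans with (4 * (d * (m * L))); [lra|].
    replace (4 * (d * (m * L))) with (8 * e * d ^ 2 * (L * L)) by (unfold m; ring).
    apply Rle_trans with (8 * e * d ^ 2 * ((L + 1) * (L + 1))).
    + apply Rmult_le_compat_l; [|nra].
      apply Rmult_le_pos; [lra|apply pow2_ge_0].
    + right; unfold e; field; lra. }
unfold I, A, B in HI; rewrite !Rplus_0_l in HI.
rewrite (CRint_ext (fun t => f (c1 t) * c1' t)%C (fun t => f (H 1 t) * Ht 1 t)%C).
- rewrite (CRint_ext (fun t => f (c0 t) * c0' t)%C (fun t => f (H 0 t) * Ht 0 t)%C);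
    [exact HI|lra|].
  intros t Hr; unfold H, Ht; f_equal; [f_equal|]; ring.
- lra.
- intros t Hr; unfold H, Ht; f_equal; [f_equal|]; ring.
Qed.

(** * Primitives *)

Lemma Cmod_minus_triangle (a b : C) : Cmod a - Cmod b <= Cmod (a - b).
Proof.
assert (T := Cmod_triangle (a - b) b).
replace (a - b + b)%C with a in T by ring; lra.
Qed.

Lemma Cmod_minus_sym (a b : C) : Cmod (a - b) = Cmod (b - a).
Proof. rewrite <- Cmod_opp; f_equal; ring. Qed.

(** Explicit kernels give remainders of this kind directly, and a quadratic bound survives
    integration over a parameter. *)
Lemma cderiv_quadratic f z l m K : 0 < m -> 0 <= K ->
  (forall w, Cmod (w - z) < m ->
     Cmod (f w - f z - l * (w - z)) <= K * Cmod (w - z) ^ 2) -> cderiv f z l.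
Proof.
intros Hm HK H eps Heps.
exists (Rmin m (eps / (K + 1))); split.
{ apply Rmin_glb_lt; [exact Hm|apply Rdiv_lt_0_compat; lra]. }
intros w Hw.
assert (Hw1 := Rlt_le_trans _ _ _ Hw (Rmin_l _ _)).
assert (Hw2 := Rlt_le_trans _ _ _ Hw (Rmin_r _ _)).
eapply Rle_trans; [apply H, Hw1|].
apply (Rmult_lt_compat_l (K + 1)) in Hw2; [|lra].
replace ((K + 1) * (eps / (K + 1))) with eps in Hw2 by (field; lra).
assert (Hp := Cmod_ge_0 (w - z)); nra.
Qed.

Lemma Cmod_pos_neq z : 0 < Cmod z -> z <> RtoC 0.
Proof. intros H E; rewrite E, Cmod_0 in H; lra. Qed.

Lemma Cmod_inv_le z m : 0 < m <= Cmod z -> Cmod (/ z) <= / m.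
Proof.
intros H; rewrite Cmod_inv by (apply Cmod_pos_neq; lra).
apply Rinv_le_contravar; lra.
Qed.

Lemma cderiv_inv z : z <> RtoC 0 -> cderiv Cinv z (- (/ z * / z))%C.
Proof.
intros Hz; assert (Hp : 0 < Cmod z) by (apply Cmod_gt_0, Hz).
(* Within [m] of [z] every [w] satisfies [Cmod w >= m], so [/ w] and [/ z] are both at most [/ m] in
   modulus. *)
set (m := Cmod z / 2).
assert (Hm : 0 < / m) by (apply Rinv_0_lt_compat; unfold m; lra).
apply (cderiv_quadratic _ _ _ m (/ m * / m * / m)).
- unfold m; lra.
- assert (0 < / m * / m) by nra; nra.
- intros w Hw.
  assert (Hwm : m <= Cmod w).
  { assert (T := Cmod_minus_triangle z w); rewrite Cmod_minus_sym in T; unfold m in *; lra. }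
  assert (Hw0 : w <> RtoC 0) by (apply Cmod_pos_neq; unfold m in *; lra).
  replace (/ w - / z - - (/ z * / z) * (w - z))%C with
    (/ w * / z * / z * ((w - z) * (w - z)))%C by (field; split; assumption).
  rewrite !Cmod_mult.
  replace (Cmod (w - z) ^ 2) with (Cmod (w - z) * Cmod (w - z)) by ring.
  assert (H1 := Cmod_inv_le w m ltac:(unfold m in *; lra)).
  assert (H2 := Cmod_inv_le z m ltac:(unfold m in *; lra)).
  assert (P := Cmod_ge_0).
  apply Rmult_le_compat_r; [apply Rmult_le_pos; apply P|].
  repeat apply Rmult_le_compat; auto; apply Rmult_le_pos; auto.
Qed.

Lemma holoD_iff f : holoD f <-> forall z, inD z -> exists l, cderiv f z l.
Proof.
split; intros H z Hz; destruct (H z Hz) as [l Hl]; exists l; apply cderiv_is_derive, Hl.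
Qed.

Lemma Cderiv_correct f z : holoD f -> inD z -> cderiv f z (Cderiv f z).
Proof.
intros H Hz; apply cderiv_is_derive; unfold Cderiv.
apply epsilon_spec; exact (H z Hz).
Qed.

Lemma Cderiv_eq f z l : cderiv f z l -> Cderiv f z = l.
Proof.
intros H; apply (cderiv_unique f z); [|exact H].
apply cderiv_is_derive; unfold Cderiv; apply epsilon_spec.
exists l; apply cderiv_is_derive, H.
Qed.

(** Written along the segment from 0 exactly as in [Sg], so that [Sg g f] is a [cprimitive] by
    conversion. *)
Definition cprimitive (h : C -> C) (z : C) : C :=
  CRint (fun t => h (RtoC t * z) * z)%C 0 1.

Lemma cprimitive_0 h : cprimitive h 0 = RtoC 0.
Proof.
unfold cprimitive; rewrite (CRint_ext _ (fun _ => RtoC 0)); [apply CRint_const|lra|].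
intros t _; apply Cmult_0_r.
Qed.

Lemma holo_path_continuous h c c' a b :
  holoD h -> (forall t, a <= t <= b -> pderiv c t (c' t)) ->
  (forall t, a <= t <= b -> inD (c t)) -> Ccont_on (fun t => h (c t)) a b.
Proof.
intros Hh Hc HD t Ht.
apply (continuous_comp (V := C_UniformSpace) c h).
- apply (pderiv_continuous _ _ _ (Hc t Ht)).
- apply (cderiv_continuous h _ _ (Cderiv_correct h _ Hh (HD t Ht))).
Qed.

Lemma segment_in_D z h t : inD z -> Cmod h < 1 - Cmod z -> 0 <= t <= 1 ->
  inD (z + RtoC t * h)%C.
Proof.
intros Hz Hh Ht; unfold inD.
eapply Rle_lt_trans; [apply Cmod_triangle|].
rewrite Cmod_mult, Cmod_R, Rabs_pos_eq by lra.
generalize (Cmod_ge_0 h); nra.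
Qed.

Lemma scaled_in_D z t : inD z -> 0 <= t <= 1 -> inD (RtoC t * z)%C.
Proof.
unfold inD; intros Hz Ht; rewrite Cmod_mult, Cmod_R, Rabs_pos_eq by lra.
generalize (Cmod_ge_0 z); nra.
Qed.

(** Cauchy's theorem for the triangle with vertices 0, [z], [z + h]: the homotopy goes from the
    constant path 0 to the segment from [z] to [z + h], and its two side edges are the segments
    defining the primitives. *)
Lemma cprimitive_increment f z h : holoD f -> inD z -> Cmod h < 1 - Cmod z ->
  (cprimitive f (z + h) - cprimitive f z)%C = CRint (fun t => f (z + RtoC t * h) * h)%C 0 1.
Proof.
intros Hf Hz Hh.
assert (HD : forall t, 0 <= t <= 1 -> inD (z + RtoC t * h)%C)
  by (intros t Ht; apply segment_in_D; assumption).
unshelve epose proof (goursat_homotopy f (fun _ => RtoC 0) (fun t => z + RtoC t * h)%C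
  (fun _ => RtoC 0) (fun _ => h) 1 _ _ _ _ _ _ _ _) as G; cbv beta in *.
- intros t _; apply continuous_const.
- intros t _; apply continuous_const.
- intros t _; apply pderiv_const.
- intros t _; apply pderiv_affine.
- intros t _; rewrite Cmod_0; lra.
- intros t _; generalize (Cmod_ge_0 z); lra.
- intros t Ht; replace (z + RtoC t * h - 0)%C with (z + RtoC t * h)%C by ring.
  apply Rlt_le, HD, Ht.
- intros s t Hs Ht.
  replace (0 + RtoC s * (z + RtoC t * h - 0))%C with (RtoC s * (z + RtoC t * h))%C by ring.
  eexists; apply Cderiv_correct; [exact Hf|]; apply scaled_in_D; [apply HD, Ht|exact Hs].
- unfold cprimitive.
  rewrite (CRint_ext (fun t => f (RtoC t * (z + h)) * (z + h))%C
     (fun s => f (0 + RtoC s * (z + 1 * h - 0)) * (z + 1 * h - 0))%C);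
    [|lra|intros t _; f_equal; [f_equal|]; ring].
  rewrite (CRint_ext (fun t => f (RtoC t * z) * z)%C
     (fun s => f (0 + RtoC s * (z + 0 * h - 0)) * (z + 0 * h - 0))%C);
    [|lra|intros t _; f_equal; [f_equal|]; ring].
  assert (E0 : CRint (fun _ => f 0 * 0)%C 0 1 = RtoC 0)
    by (rewrite CRint_const; apply Cmult_0_r).
  rewrite E0 in G.
  match type of G with (?a + ?b - ?c - _)%C = _ => replace b with (c - a)%C; [reflexivity|];
    replace b with (a + b - c - 0 + (c - a))%C by ring; rewrite G; ring end.
Qed.

Lemma cprimitive_cderiv f z : holoD f -> inD z -> cderiv (cprimitive f) z (f z).
Proof.
intros Hf Hz eps Heps.
destruct (proj1 (continuous_C_loc f z)
  (cderiv_continuous f z _ (Cderiv_correct f z Hf Hz)) eps Heps) as [d [Hd Hd']].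
exists (Rmin d (1 - Cmod z)); split.
{ apply Rmin_glb_lt; [exact Hd|unfold inD in Hz; lra]. }
intros w Hw.
assert (Hw1 := Rlt_le_trans _ _ _ Hw (Rmin_l _ _)).
assert (Hw2 := Rlt_le_trans _ _ _ Hw (Rmin_r _ _)).
set (h := (w - z)%C) in *.
replace w with (z + h)%C by (unfold h; ring).
rewrite (cprimitive_increment f z h Hf Hz Hw2).
assert (HD : forall t, 0 <= t <= 1 -> inD (z + RtoC t * h)%C)
  by (intros t Ht; apply segment_in_D; assumption).
assert (Hcont : Ccont_on (fun t => f (z + RtoC t * h)%C) 0 1).
{ apply (holo_path_continuous f (fun t => z + RtoC t * h)%C (fun _ => h)); auto.
  intros t _; apply pderiv_affine. }
(* The linear term becomes an integral of a constant, so that only [f (z + RtoC t * h) - f z] has to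
   be small, by continuity at [z]. *)
rewrite <- (CRint_const (f z * h)%C) at 1.
rewrite <- CRint_minus; [|lra| |intros t _; apply continuous_const].
2:{ intros t Ht; apply continuous_Cmult; [apply Hcont, Ht|apply continuous_const]. }
replace (eps * Cmod h) with ((1 - 0) * (eps * Cmod h)) by ring.
apply CRint_bound; [lra| |].
- intros t Ht; apply (continuous_minus (K := R_AbsRing) (V := C_R_NormedModule));
    [|apply continuous_const].
  apply continuous_Cmult; [apply Hcont, Ht|apply continuous_const].
- intros t Ht.
  replace (f (z + RtoC t * h) * h - f z * h)%C with ((f (z + RtoC t * h)%C - f z) * h)%C by ring.
  rewrite Cmod_mult; apply Rmult_le_compat_r; [apply Cmod_ge_0|].
  apply Rlt_le, Hd'.
  replace (z + RtoC t * h - z)%C with (RtoC t * h)%C by ring.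
  rewrite Cmod_mult, Cmod_R, Rabs_pos_eq by lra.
  generalize (Cmod_ge_0 h); nra.
Qed.

(** * The unit circle as a closed path on [0, 1] *)

Definition circ (t : R) : C := (cos (2 * PI * t), sin (2 * PI * t)).

Lemma Cmod_circ t : Cmod (circ t) = 1.
Proof.
unfold Cmod, circ; simpl.
replace (cos (2 * PI * t) * (cos (2 * PI * t) * 1) + sin (2 * PI * t) * (sin (2 * PI * t) * 1))
  with 1 by (generalize (sin2_cos2 (2 * PI * t)); unfold Rsqr; lra).
apply sqrt_1.
Qed.

Lemma circ_0 : circ 0 = RtoC 1.
Proof. unfold circ; rewrite Rmult_0_r, cos_0, sin_0; reflexivity. Qed.

Lemma circ_1 : circ 1 = RtoC 1.
Proof. unfold circ; rewrite Rmult_1_r, cos_2PI, sin_2PI; reflexivity. Qed.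

Lemma pderiv_pair (a b : R -> R) t (la lb : R) :
  is_derive a t la -> is_derive b t lb -> pderiv (fun u => (a u, b u)) t (la, lb).
Proof.
intros [_ Ha] [_ Hb] eps Heps.
assert (He : 0 < eps / 2) by lra.
destruct (Ha t (fun P HP => HP) (mkposreal _ He)) as [d1 H1].
destruct (Hb t (fun P HP => HP) (mkposreal _ He)) as [d2 H2].
exists (Rmin d1 d2); split; [apply Rmin_glb_lt; apply cond_pos|].
intros u Hu.
specialize (H1 u (Rlt_le_trans _ _ _ Hu (Rmin_l _ _))).
specialize (H2 u (Rlt_le_trans _ _ _ Hu (Rmin_r _ _))).
change (Rabs (a u - a t - (u - t) * la) <= eps / 2 * Rabs (u - t)) in H1.
change (Rabs (b u - b t - (u - t) * lb) <= eps / 2 * Rabs (u - t)) in H2.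
replace ((a u, b u) - (a t, b t) - (la, lb) * RtoC (u - t))%C with
  (RtoC (a u - a t - (u - t) * la) + Ci * RtoC (b u - b t - (u - t) * lb))%C
  by (apply injective_projections; simpl; ring).
eapply Rle_trans; [apply Cmod_triangle|].
rewrite Cmod_mult, !Cmod_R, Cmod_Ci; lra.
Qed.

Definition twopii : C := (RtoC (2 * PI) * Ci)%C.

Lemma Cmod_twopii : Cmod twopii = 2 * PI.
Proof.
unfold twopii; rewrite Cmod_mult, Cmod_R, Cmod_Ci, Rabs_pos_eq; [ring|].
generalize PI_RGT_0; lra.
Qed.

Lemma pderiv_circ t : pderiv circ t (twopii * circ t)%C.
Proof.
replace (twopii * circ t)%C with
  ((- (2 * PI * sin (2 * PI * t)))%R, (2 * PI * cos (2 * PI * t))%R)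
  by (apply injective_projections; simpl; ring).
apply (pderiv_pair (fun u => cos (2 * PI * u)) (fun u => sin (2 * PI * u)));
  auto_derive; trivial; ring.
Qed.

(** * Cauchy's formula *)

Lemma pderiv_circle a r t :
  pderiv (fun t => a + RtoC r * circ t)%C t (RtoC r * (twopii * circ t))%C.
Proof.
rewrite <- Cplus_0_l; apply pderiv_plus; [apply pderiv_const|].
apply pderiv_scal, pderiv_circ.
Qed.

Lemma continuous_circ_deriv r t :
  continuous (U := C_UniformSpace) (fun t => RtoC r * (twopii * circ t))%C t.
Proof.
apply continuous_Cmult; [apply continuous_const|].
apply continuous_Cmult; [apply continuous_const|].
apply (pderiv_continuous _ _ _ (pderiv_circ t)).
Qed.

Lemma circle_in_D r a t : 0 < r -> Cmod a + r < 1 -> inD (a + RtoC r * circ t)%C.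
Proof.
intros Hr Ha; unfold inD; eapply Rle_lt_trans; [apply Cmod_triangle|].
rewrite Cmod_mult, Cmod_circ, Cmod_R, Rabs_pos_eq; lra.
Qed.

(** The straight-line homotopy between the two circles avoids [a], so Goursat applies to
    [f w * / (w - a)]. Both circles are closed, hence the two side edges coincide and cancel; on the
    small circle the factor [RtoC delta * circ t] of the derivative cancels the denominator. *)
Lemma cauchy_deform f r a delta : holoD f -> 0 < r < 1 -> 0 < delta -> Cmod a + delta < r ->
  CRint (fun t => f (0 + RtoC r * circ t) * (RtoC r * (twopii * circ t)) *
     / (0 + RtoC r * circ t - a))%C 0 1 =
  CRint (fun t => f (a + RtoC delta * circ t) * twopii)%C 0 1.
Proof.
intros Hf Hr Hd Had.
assert (Ha0 := Cmod_ge_0 a).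
assert (Hpi := PI_RGT_0).
assert (Hc : forall t, Cmod (0 + RtoC r * circ t) = r).
{ intros t; rewrite Cplus_0_l, Cmod_mult, Cmod_circ, Cmod_R, Rabs_pos_eq; lra. }
assert (Hc' : forall t, Cmod (a + RtoC delta * circ t) <= Cmod a + delta).
{ intros t; eapply Rle_trans; [apply Cmod_triangle|].
  rewrite Cmod_mult, Cmod_circ, Cmod_R, Rabs_pos_eq; lra. }
unshelve epose proof (goursat_homotopy (fun w => f w * / (w - a))%C
  (fun t => a + RtoC delta * circ t)%C (fun t => 0 + RtoC r * circ t)%C
  (fun t => RtoC delta * (twopii * circ t))%C (fun t => RtoC r * (twopii * circ t))%C
  (2 * PI + 3) _ _ _ _ _ _ _ _) as G; cbv beta in *.
- intros t _; apply continuous_circ_deriv.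
- intros t _; apply continuous_circ_deriv.
- intros t _; apply pderiv_circle.
- intros t _; apply pderiv_circle.
- intros t _; rewrite !Cmod_mult, Cmod_twopii, Cmod_circ, Cmod_R, Rabs_pos_eq; nra.
- intros t _; rewrite !Cmod_mult, Cmod_twopii, Cmod_circ, Cmod_R, Rabs_pos_eq; nra.
- intros t _; unfold Cminus; eapply Rle_trans; [apply Cmod_triangle|].
  rewrite Hc, Cmod_opp; specialize (Hc' t); lra.
- intros s t Hs Ht.
  set (w := (a + RtoC delta * circ t +
     RtoC s * (0 + RtoC r * circ t - (a + RtoC delta * circ t)))%C).
  assert (HD : inD w).
  { unfold inD.
    replace w with (RtoC (1 - s) * (a + RtoC delta * circ t) +
       RtoC s * (0 + RtoC r * circ t))%C by (unfold w; rewrite RtoC_minus; ring).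
    eapply Rle_lt_trans; [apply Cmod_triangle|].
    rewrite !(Cmod_mult (RtoC _)), Hc, !Cmod_R, !Rabs_pos_eq by lra.
    specialize (Hc' t); nra. }
  (* [w - a] is [circ t] scaled by [(1 - s) * delta + s * r], minus [RtoC s * a]; since
     [Cmod a < r], the first term dominates. *)
  assert (Hwa : (w - a)%C <> RtoC 0).
  { apply Cmod_pos_neq.
    replace (w - a)%C with (RtoC ((1 - s) * delta + s * r) * circ t - RtoC s * a)%C
      by (unfold w; rewrite RtoC_plus, !RtoC_mult, RtoC_minus; ring).
    eapply Rlt_le_trans; [|apply Cmod_minus_triangle].
    rewrite !Cmod_mult, Cmod_circ, !Cmod_R, !Rabs_pos_eq by nra; nra. }
  eexists; apply (cderiv_mult f (fun w => / (w - a))%C).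
  + apply Cderiv_correct; assumption.
  + apply (cderiv_comp Cinv (fun w => w - a)%C); [apply cderiv_inv, Hwa|].
    apply (cderiv_plus (fun w => w) (fun _ => (- a)%C)); [apply cderiv_id|apply cderiv_const].
- rewrite circ_0, circ_1 in G.
  rewrite (CRint_ext (fun t => f (0 + RtoC r * circ t) * (RtoC r * (twopii * circ t)) *
       / (0 + RtoC r * circ t - a))%C (fun t => f (0 + RtoC r * circ t) * / (0 + RtoC r * circ t - a) *
       (RtoC r * (twopii * circ t)))%C); [|lra|intros t _; ring].
  rewrite (CRint_ext (fun t => f (a + RtoC delta * circ t) * twopii)%C
    (fun t => f (a + RtoC delta * circ t) * / (a + RtoC delta * circ t - a) *
       (RtoC delta * (twopii * circ t)))%C).
  2: lra.
  2:{ intros t _.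
    replace (a + RtoC delta * circ t - a)%C with (RtoC delta * circ t)%C by ring.
    field; split; [|]; apply Cmod_pos_neq.
    - rewrite Cmod_circ; lra.
    - rewrite Cmod_R, Rabs_pos_eq; lra. }
  match type of G with (?a + ?b - _ - ?d)%C = _ =>
    replace b with (a + b - a - d + d)%C by ring; rewrite G; ring end.
Qed.

(** By deformation the integral equals the mean over any small circle around [a], times [twopii];
    continuity of [f] at [a] then excludes a positive distance to [f a * twopii]. *)
Lemma cauchy_formula f r a : holoD f -> 0 < r < 1 -> Cmod a < r ->
  CRint (fun t => f (0 + RtoC r * circ t) * (RtoC r * (twopii * circ t)) *
     / (0 + RtoC r * circ t - a))%C 0 1 = (f a * twopii)%C.
Proof.
intros Hf Hr Ha.
set (X := CRint _ 0 1).
assert (Hpi := PI_RGT_0); assert (Ha0 := Cmod_ge_0 a).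
assert (HaD : inD a) by (unfold inD; lra).
destruct (Rle_lt_or_eq_dec 0 (Cmod (X - f a * twopii)) (Cmod_ge_0 _)) as [H|H].
2:{ replace X with ((X - f a * twopii) + f a * twopii)%C by ring.
    rewrite (Cmod_eq_0 _ (eq_sym H)); ring. }
exfalso; set (e := Cmod (X - f a * twopii)) in *.
(* Multiplied by [Cmod twopii = 2 * PI] this tolerance yields [e / 2], which contradicts the
   distance being [e]. *)
assert (He : 0 < e / (4 * PI)) by (apply Rdiv_lt_0_compat; lra).
destruct (proj1 (continuous_C_loc f a)
  (cderiv_continuous f a _ (Cderiv_correct f a Hf HaD)) _ He) as [d [Hd Hd']].
set (delta := Rmin (d / 2) ((r - Cmod a) / 2)).
assert (H1 : delta <= d / 2) by apply Rmin_l.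
assert (H2 : delta <= (r - Cmod a) / 2) by apply Rmin_r.
assert (H0 : 0 < delta) by (apply Rmin_glb_lt; lra).
assert (E := cauchy_deform f r a delta Hf Hr H0 ltac:(lra)).
fold X in E; revert H; unfold e at 1; rewrite E.
assert (Hcont : Ccont_on (fun t => f (a + RtoC delta * circ t)%C) 0 1).
{ apply (holo_path_continuous f _ (fun t => RtoC delta * (twopii * circ t))%C); auto.
  - intros t _; apply pderiv_circle.
  - intros t _; apply circle_in_D; lra. }
assert (B : Cmod (X - f a * twopii) <= (1 - 0) * (e / (4 * PI) * (2 * PI))).
{ rewrite E; rewrite <- (CRint_const (f a * twopii)%C) at 1.
  rewrite <- CRint_minus; [|lra| |intros t _; apply continuous_const].
  2:{ intros t Ht; apply continuous_Cmult; [apply Hcont, Ht|apply continuous_const]. }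
  apply CRint_bound; [lra| |].
  - intros t Ht; apply (continuous_minus (K := R_AbsRing) (V := C_R_NormedModule));
      [|apply continuous_const].
    apply continuous_Cmult; [apply Hcont, Ht|apply continuous_const].
  - intros t Ht.
    replace (f (a + RtoC delta * circ t) * twopii - f a * twopii)%C
      with ((f (a + RtoC delta * circ t)%C - f a) * twopii)%C by ring.
    rewrite Cmod_mult, Cmod_twopii; apply Rmult_le_compat_r; [lra|].
    apply Rlt_le, Hd'.
    replace (a + RtoC delta * circ t - a)%C with (RtoC delta * circ t)%C by ring.
    rewrite Cmod_mult, Cmod_circ, Cmod_R, Rabs_pos_eq; lra. }
fold e in B; intros _.
replace ((1 - 0) * (e / (4 * PI) * (2 * PI))) with (e / 2) in B by (field; lra).
assert (0 < e).
{ replace e with (e / (4 * PI) * (4 * PI)) by (field; lra); apply Rmult_lt_0_compat; lra. }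
lra.
Qed.

(** * Differentiation of Cauchy integrals *)

Lemma continuous_bounded (k : R -> C) a b : a <= b -> Ccont_on k a b ->
  exists M, 0 <= M /\ forall t, a <= t <= b -> Cmod (k t) <= M.
Proof.
intros Hab Hk.
destruct (continuity_ab_maj (fun t => Cmod (k t)) a b Hab) as [x [Hx _]].
{ intros t Ht; apply continuity_pt_filterlim.
  apply filterlim_locally; intros eps.
  apply filter_imp with (2 := proj1 (continuous_C k t) (Hk t Ht) eps (cond_pos eps)).
  intros y Hy.
  change (Rabs (Cmod (k y) - Cmod (k t)) < eps).
  assert (T := Cmod_minus_triangle (k y) (k t)).
  assert (T' := Cmod_minus_triangle (k t) (k y)); rewrite Cmod_minus_sym in T'.
  apply Rabs_def1; lra. }
exists (Cmod (k x)); split; [apply Cmod_ge_0|exact Hx].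
Qed.

(** A quadratic remainder bound uniform in [t] integrates to the same bound, so no dominated
    convergence is required. *)
Lemma cderiv_under_integral (q : C -> R -> C) (q' : R -> C) z m K :
  0 < m -> 0 <= K ->
  (forall w, Cmod (w - z) < m -> Ccont_on (q w) 0 1) -> Ccont_on q' 0 1 ->
  (forall w t, Cmod (w - z) < m -> 0 <= t <= 1 ->
     Cmod (q w t - q z t - (w - z) * q' t) <= K * Cmod (w - z) ^ 2) ->
  cderiv (fun w => CRint (q w) 0 1) z (CRint q' 0 1).
Proof.
intros Hm HK Hq Hq' H.
apply (cderiv_quadratic _ _ _ m K Hm HK); intros w Hw.
assert (Hz : Cmod (z - z) < m)
  by (replace (z - z)%C with (RtoC 0) by ring; rewrite Cmod_0; exact Hm).
assert (H1 : Ccont_on (fun t => q w t - q z t)%C 0 1).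
{ intros t Ht; apply (continuous_minus (K := R_AbsRing) (V := C_R_NormedModule));
    [apply Hq|apply Hq]; assumption. }
assert (H2 : Ccont_on (fun t => (w - z) * q' t)%C 0 1).
{ intros t Ht; apply continuous_Cmult; [apply continuous_const|apply Hq', Ht]. }
rewrite (Cmult_comm _ (w - z)), <- CRint_scal by (assumption || lra).
rewrite <- CRint_minus by (auto || lra).
rewrite <- CRint_minus by (auto || lra).
replace (K * Cmod (w - z) ^ 2) with ((1 - 0) * (K * Cmod (w - z) ^ 2)) by ring.
apply CRint_bound; [lra| |intros t Ht; apply H; assumption].
intros t Ht; apply (continuous_minus (K := R_AbsRing) (V := C_R_NormedModule));
  [apply H1|apply H2]; exact Ht.
Qed.

Section CauchyKernel.
Variables (k gamma : R -> C) (r M : R) (z : C).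
Hypothesis Hk : Ccont_on k 0 1.
Hypothesis Hgamma : Ccont_on gamma 0 1.
Hypothesis HM : 0 <= M.
Hypothesis HkM : forall t, 0 <= t <= 1 -> Cmod (k t) <= M.
Hypothesis Hr : forall t, 0 <= t <= 1 -> Cmod (gamma t) = r.
Hypothesis Hz : Cmod z < r.

(** Half the distance from [z] to the circle of radius [r]: points within [m] of [z] stay at least
    [m] away from [gamma]. *)
Let m := (r - Cmod z) / 2.

Lemma kernel_far w t : Cmod (w - z) < m -> 0 <= t <= 1 -> m <= Cmod (gamma t - w).
Proof using Hr Hz.
intros Hw Ht.
assert (T1 := Cmod_minus_triangle (gamma t) w).
assert (T2 := Cmod_minus_triangle w z).
rewrite (Hr t Ht) in T1; unfold m in *; lra.
Qed.

Lemma kernel_continuous w : Cmod (w - z) < m ->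
  Ccont_on (fun t => / (gamma t - w))%C 0 1.
Proof using Hr Hz Hgamma.
intros Hw t Ht.
apply (continuous_comp (V := C_UniformSpace) (fun t => gamma t - w)%C Cinv).
- apply (continuous_minus (K := R_AbsRing) (V := C_R_NormedModule));
    [apply Hgamma, Ht|apply continuous_const].
- eapply cderiv_continuous, cderiv_inv, Cmod_pos_neq.
  eapply Rlt_le_trans; [|apply (kernel_far w t Hw Ht)]; unfold m; lra.
Qed.

Let Hm : 0 < m.
Proof. unfold m; lra. Qed.

Let Hzz : Cmod (z - z) < m.
Proof. replace (z - z)%C with (RtoC 0) by ring; rewrite Cmod_0; exact Hm. Qed.

Lemma kernel_inv_bound w t : Cmod (w - z) < m -> 0 <= t <= 1 ->
  Cmod (/ (gamma t - w)) <= / m.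
Proof using Hr Hz.
intros Hw Ht; apply Cmod_inv_le; split; [exact Hm|apply kernel_far; assumption].
Qed.

Lemma kernel_neq w t : Cmod (w - z) < m -> 0 <= t <= 1 -> (gamma t - w)%C <> RtoC 0.
Proof using Hr Hz.
intros Hw Ht; apply Cmod_pos_neq; eapply Rlt_le_trans; [exact Hm|].
apply kernel_far; assumption.
Qed.

Lemma cauchy_kernel_cderiv :
  cderiv (fun w => CRint (fun t => k t * / (gamma t - w))%C 0 1) z
    (CRint (fun t => k t * (/ (gamma t - z) * / (gamma t - z)))%C 0 1).
Proof using All.
apply (cderiv_under_integral (fun w t => k t * / (gamma t - w))%C _ z m
  (M * (/ m * / m * / m))).
- exact Hm.
- assert (0 < / m) by (apply Rinv_0_lt_compat, Hm).
  apply Rmult_le_pos; [exact HM|]; repeat apply Rmult_le_pos; lra.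
- intros w Hw t Ht; apply continuous_Cmult; [apply Hk, Ht|apply kernel_continuous; assumption].
- intros t Ht; apply continuous_Cmult; [apply Hk, Ht|].
  apply continuous_Cmult; apply kernel_continuous; assumption.
- intros w t Hw Ht.
  replace (k t * / (gamma t - w) - k t * / (gamma t - z) -
     (w - z) * (k t * (/ (gamma t - z) * / (gamma t - z))))%C
   with (k t * (/ (gamma t - w) * / (gamma t - z) * / (gamma t - z)) * ((w - z) * (w - z)))%C
   by (field; split; apply kernel_neq; assumption).
  rewrite !Cmod_mult.
  replace (Cmod (w - z) ^ 2) with (Cmod (w - z) * Cmod (w - z)) by ring.
  assert (P := Cmod_ge_0).
  assert (B1 := kernel_inv_bound w t Hw Ht).
  assert (B2 := kernel_inv_bound z t Hzz Ht).
  apply Rmult_le_compat_r; [apply Rmult_le_pos; apply P|].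
  repeat apply Rmult_le_compat; auto; repeat apply Rmult_le_pos; auto.
Qed.

(** Differentiates the derivative found in [cauchy_kernel_cderiv] once more; this is what makes [f']
    holomorphic. *)
Lemma cauchy_kernel_cderiv2 :
  cderiv (fun w => CRint (fun t => k t * (/ (gamma t - w) * / (gamma t - w)))%C 0 1) z
    (CRint (fun t => k t * (2 * (/ (gamma t - z) * / (gamma t - z) * / (gamma t - z))))%C 0 1).
Proof using All.
assert (Him : 0 < / m) by (apply Rinv_0_lt_compat, Hm).
assert (H1 : 0 <= / m * / m * / m) by (repeat apply Rmult_le_pos; lra).
apply (cderiv_under_integral (fun w t => k t * (/ (gamma t - w) * / (gamma t - w)))%C _ z m
  (M * (3 * (/ m * / m * / m * / m)))).
- exact Hm.
- apply Rmult_le_pos; [exact HM|]; repeat apply Rmult_le_pos; lra.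
- intros w Hw t Ht; apply continuous_Cmult; [apply Hk, Ht|].
  apply continuous_Cmult; apply kernel_continuous; assumption.
- intros t Ht; apply continuous_Cmult; [apply Hk, Ht|].
  apply continuous_Cmult; [apply continuous_const|].
  apply continuous_Cmult; [apply continuous_Cmult|]; apply kernel_continuous; assumption.
- intros w t Hw Ht.
  set (u := (/ (gamma t - w))%C); set (v := (/ (gamma t - z))%C).
  (* From [u - v = (w - z) * u * v], applied twice. The coefficients 1 and 2 of the resulting terms
     account for the constant 3 in the bound. *)
  replace (k t * (u * u) - k t * (v * v) - (w - z) * (k t * (2 * (v * v * v))))%C
   with (k t * (u * u * v * v + 2 * (u * v * v * v)) * ((w - z) * (w - z)))%C
   by (unfold u, v; field; split; apply kernel_neq; assumption).
  rewrite !(Cmod_mult _ ((w - z) * (w - z))), (Cmod_mult (w - z)), (Cmod_mult (k t)).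
  replace (Cmod (w - z) ^ 2) with (Cmod (w - z) * Cmod (w - z)) by ring.
  assert (P := Cmod_ge_0).
  assert (B1 := kernel_inv_bound w t Hw Ht : Cmod u <= / m).
  assert (B2 := kernel_inv_bound z t Hzz Ht : Cmod v <= / m).
  apply Rmult_le_compat_r; [apply Rmult_le_pos; apply P|].
  apply Rmult_le_compat; auto.
  eapply Rle_trans; [apply Cmod_triangle|].
  rewrite !Cmod_mult, Cmod_R, Rabs_pos_eq by lra.
  assert (Cmod u * Cmod u * Cmod v * Cmod v <= / m * / m * / m * / m)
   by (repeat apply Rmult_le_compat; auto; repeat apply Rmult_le_pos; auto).
  assert (Cmod u * Cmod v * Cmod v * Cmod v <= / m * / m * / m * / m)
   by (repeat apply Rmult_le_compat; auto; repeat apply Rmult_le_pos; auto).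
  lra.
Qed.

Lemma cauchy_kernel_bound :
  Cmod (CRint (fun t => k t * / (gamma t - z))%C 0 1) <= M * / m.
Proof using All.
replace (M * / m) with ((1 - 0) * (M * / m)) by ring.
apply CRint_bound; [lra| |].
- intros t Ht; apply continuous_Cmult; [apply Hk, Ht|apply kernel_continuous; assumption].
- intros t Ht; rewrite Cmod_mult; apply Rmult_le_compat; auto using Cmod_ge_0.
  apply kernel_inv_bound; assumption.
Qed.
End CauchyKernel.

Lemma cderiv_scal k f z l : cderiv f z l -> cderiv (fun w => k * f w)%C z (k * l)%C.
Proof.
intros H; assert (Hm := cderiv_mult (fun _ => k) f z _ _ (cderiv_const k z) H).
cbv beta in Hm; replace (0 * f z + k * l)%C with (k * l)%C in Hm by ring; exact Hm.
Qed.

Lemma twopii_neq : twopii <> RtoC 0.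
Proof. apply Cmod_pos_neq; rewrite Cmod_twopii; generalize PI_RGT_0; lra. Qed.

(** Cauchy's formula in the shape of the kernel lemmas: the density [k] is [f] times the derivative
    of [gamma], divided by [twopii], and [M] exists because [k] is continuous on a compact
    interval. *)
Lemma cauchy_representation f r : holoD f -> 0 < r < 1 ->
  exists k : R -> C, exists M,
    let gamma := fun t => (0 + RtoC r * circ t)%C in
    Ccont_on k 0 1 /\ Ccont_on gamma 0 1 /\ 0 <= M /\
    (forall t, 0 <= t <= 1 -> Cmod (k t) <= M) /\
    (forall t, 0 <= t <= 1 -> Cmod (gamma t) = r) /\
    (forall w, Cmod w < r -> f w = CRint (fun t => k t * / (gamma t - w))%C 0 1).
Proof.
intros Hf Hr.
set (gamma := fun t => (0 + RtoC r * circ t)%C).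
set (k := fun t => (/ twopii * (f (gamma t) * (RtoC r * (twopii * circ t))))%C).
assert (Hg : Ccont_on gamma 0 1)
  by (intros t _; apply (pderiv_continuous _ _ _ (pderiv_circle 0 r t))).
assert (Hk0 : Ccont_on (fun t => f (gamma t) * (RtoC r * (twopii * circ t)))%C 0 1).
{ intros t Ht; apply continuous_Cmult; [|apply continuous_circ_deriv].
  apply (holo_path_continuous f gamma (fun t => RtoC r * (twopii * circ t))%C 0 1); auto.
  - intros u _; apply pderiv_circle.
  - intros u _; apply circle_in_D; rewrite ?Cmod_0; lra. }
assert (Hk : Ccont_on k 0 1)
  by (intros t Ht; apply continuous_Cmult; [apply continuous_const|apply Hk0, Ht]).
destruct (continuous_bounded k 0 1 Rle_0_1 Hk) as [M [HM HkM]].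
assert (Hgr : forall t, 0 <= t <= 1 -> Cmod (gamma t) = r).
{ intros t _; unfold gamma; rewrite Cplus_0_l, Cmod_mult, Cmod_circ, Cmod_R, Rabs_pos_eq; lra. }
exists k, M; repeat split; auto.
intros w Hw.
rewrite (CRint_ext _ (fun t => / twopii * (f (gamma t) * (RtoC r * (twopii * circ t)) *
   / (gamma t - w)))%C); [|lra|intros t _; unfold k; ring].
rewrite CRint_scal; [|lra|].
- unfold gamma; rewrite cauchy_formula by assumption; field; apply twopii_neq.
- intros t Ht; apply continuous_Cmult; [apply Hk0, Ht|].
  apply (kernel_continuous gamma r w Hg Hgr Hw w); [|exact Ht].
  replace (w - w)%C with (RtoC 0) by ring; rewrite Cmod_0; lra.
Qed.

(** Near [a], [f] is a Cauchy integral over a circle of radius between [Cmod a] and 1. One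
    differentiation identifies [Cderiv f] with the squared-kernel integral on a whole neighbourhood
    of [a], and that integral is differentiable at [a]. *)
Lemma holoD_Cderiv f : holoD f -> holoD (Cderiv f).
Proof.
intros Hf; apply holoD_iff; intros a Ha; unfold inD in Ha.
assert (Ha0 := Cmod_ge_0 a).
set (r := (1 + Cmod a) / 2).
destruct (cauchy_representation f r Hf ltac:(unfold r; lra))
  as (k & M & Hk & Hg & HM & HkM & Hgr & Hrep).
set (gamma := fun t => (0 + RtoC r * circ t)%C) in *.
assert (near : forall w, Cmod w < r -> 0 < r - Cmod w /\
   forall v, Cmod (v - w) < r - Cmod w -> Cmod v < r).
{ intros w Hw; split; [lra|]; intros v Hv.
  assert (T := Cmod_minus_triangle v w); lra. }
assert (Har : Cmod a < r) by (unfold r; lra).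
eexists.
destruct (near a Har) as [Hp Hn].
eapply (cderiv_ext_loc (fun w => CRint (fun t => k t * (/ (gamma t - w) * / (gamma t - w)))%C 0 1)
  _ a _ (r - Cmod a) Hp).
2: apply (cauchy_kernel_cderiv2 k gamma r M a Hk Hg HM HkM Hgr Har).
intros w Hw; symmetry; apply Cderiv_eq.
specialize (Hn w Hw); destruct (near w Hn) as [Hp' Hn'].
apply (cderiv_ext_loc (fun w => CRint (fun t => k t * / (gamma t - w))%C 0 1) _ w _ _ Hp').
- intros v Hv; symmetry; apply Hrep, Hn', Hv.
- apply (cauchy_kernel_cderiv k gamma r M w Hk Hg HM HkM Hgr Hn).
Qed.

(** Instead of compactness of the closed disk, the kernel bound on a circle of radius midway between
    [R0] and 1 is used; it grows with [Cmod w], so its value at [R0] serves all [w]. *)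
Lemma holoD_bounded f R0 : holoD f -> 0 <= R0 < 1 ->
  exists M, 0 <= M /\ forall w, Cmod w <= R0 -> Cmod (f w) <= M.
Proof.
intros Hf HR.
set (r := (1 + R0) / 2).
destruct (cauchy_representation f r Hf ltac:(unfold r; lra))
  as (k & M & Hk & Hg & HM & HkM & Hgr & Hrep).
assert (H0 : 0 < / ((r - R0) / 2)) by (apply Rinv_0_lt_compat; unfold r; lra).
exists (M * / ((r - R0) / 2)); split; [apply Rmult_le_pos; lra|].
intros w Hw; assert (Hwr : Cmod w < r) by (unfold r; lra).
rewrite (Hrep w Hwr).
eapply Rle_trans; [apply (cauchy_kernel_bound k _ r M w Hk Hg HM HkM Hgr Hwr)|].
apply Rmult_le_compat_l; [exact HM|apply Rinv_le_contravar; unfold r in *; lra].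
Qed.

(** [Cderiv f] is bounded on the closed disk of radius [R0], which is convex, so one integrates
    along segments. *)
Lemma holoD_lipschitz f R0 : holoD f -> 0 <= R0 < 1 ->
  exists L, 0 <= L /\ forall w v, Cmod w <= R0 -> Cmod v <= R0 ->
    Cmod (f w - f v) <= L * Cmod (w - v).
Proof.
intros Hf HR.
destruct (holoD_bounded (Cderiv f) R0 (holoD_Cderiv f Hf) HR) as [L [HL HfL]].
exists L; split; [exact HL|]; intros w v Hw Hv.
set (c := fun t => (v + RtoC t * (w - v))%C).
assert (Hc : forall t, 0 <= t <= 1 -> Cmod (c t) <= R0).
{ intros t Ht; unfold c.
  replace (v + RtoC t * (w - v))%C with (RtoC (1 - t) * v + RtoC t * w)%C
    by (rewrite RtoC_minus; ring).
  eapply Rle_trans; [apply Cmod_triangle|].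
  rewrite !Cmod_mult, !Cmod_R, !Rabs_pos_eq by lra; nra. }
assert (HcD : forall t, 0 <= t <= 1 -> inD (c t))
  by (intros t Ht; unfold inD; specialize (Hc t Ht); lra).
assert (H := pderiv_lipschitz (fun t => f (c t)) (fun t => Cderiv f (c t) * (w - v))%C
  (L * Cmod (w - v)) 0 1 Rle_0_1).
replace (f w) with (f (c 1)) by (f_equal; unfold c; ring).
replace (f v) with (f (c 0)) by (f_equal; unfold c; ring).
replace (L * Cmod (w - v)) with (L * Cmod (w - v) * Rabs (1 - 0))
  by (rewrite Rabs_pos_eq by lra; ring).
apply H; try lra.
- intros t Ht; apply continuous_Cmult; [|apply continuous_const].
  apply (holo_path_continuous (Cderiv f) c (fun _ => (w - v)%C) 0 1); auto.
  + apply holoD_Cderiv, Hf.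
  + intros u _; apply pderiv_affine.
- intros t Ht; apply pderiv_comp; [apply Cderiv_correct; auto|apply pderiv_affine].
- intros t Ht; rewrite Cmod_mult; apply Rmult_le_compat_r; [apply Cmod_ge_0|].
  apply HfL, Hc, Ht.
Qed.

(** * Holomorphic functions on the disk *)

Lemma holoD_mult f g : holoD f -> holoD g -> holoD (fun w => f w * g w)%C.
Proof.
intros Hf Hg; apply holoD_iff; intros z Hz; eexists.
apply cderiv_mult; apply Cderiv_correct; assumption.
Qed.

Lemma holoD_scal k f : holoD f -> holoD (fun w => k * f w)%C.
Proof.
intros Hf; apply holoD_iff; intros z Hz; eexists.
apply cderiv_scal, Cderiv_correct; assumption.
Qed.

Lemma holoD_minus f g : holoD f -> holoD g -> holoD (fun w => f w - g w)%C.
Proof.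
intros Hf Hg; apply holoD_iff; intros z Hz; eexists.
apply (cderiv_ext_loc (fun w => f w + - (1) * g w)%C _ z _ 1 Rlt_0_1).
- intros w _; ring.
- apply cderiv_plus; [|apply cderiv_scal]; apply Cderiv_correct; eassumption.
Qed.

Lemma holoD_const k : holoD (fun _ => k).
Proof. apply holoD_iff; intros z _; eexists; apply cderiv_const. Qed.

Lemma holoD_pow n : holoD (fun w => w ^ n)%C.
Proof.
induction n as [|n IH]; simpl; [apply holoD_const|].
apply holoD_mult; [|exact IH].
apply holoD_iff; intros z _; eexists; apply cderiv_id.
Qed.

Lemma holoD_dilation f rho : holoD f -> 0 <= rho <= 1 -> holoD (fun w => f (RtoC rho * w)%C).
Proof.
intros Hf Hr; apply holoD_iff; intros z Hz; eexists.
apply (cderiv_comp f (fun w => RtoC rho * w)%C).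
- apply Cderiv_correct; [exact Hf|apply scaled_in_D; assumption].
- apply cderiv_scal, cderiv_id.
Qed.

Lemma inD_0 : inD 0.
Proof. unfold inD; rewrite Cmod_0; lra. Qed.

Lemma holoD_cprimitive f : holoD f -> holoD (cprimitive f).
Proof.
intros Hf; apply holoD_iff; intros z Hz; eexists; apply cprimitive_cderiv; assumption.
Qed.

Lemma Cderiv_cprimitive f z : holoD f -> inD z -> Cderiv (cprimitive f) z = f z.
Proof. intros Hf Hz; apply Cderiv_eq, cprimitive_cderiv; assumption. Qed.

Lemma Sg_cprimitive g f : Sg g f = cprimitive (fun w => Cderiv f w * g w)%C.
Proof. reflexivity. Qed.

Lemma holoD_Sg g f : holoD g -> holoD f -> holoD (Sg g f).
Proof.
intros Hg Hf; rewrite Sg_cprimitive; apply holoD_cprimitive, holoD_mult; [apply holoD_Cderiv|]; assumption.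
Qed.

Lemma Cderiv_Sg g f z : holoD g -> holoD f -> inD z ->
  Cderiv (Sg g f) z = (Cderiv f z * g z)%C.
Proof.
intros Hg Hf Hz; rewrite Sg_cprimitive.
apply (Cderiv_cprimitive (fun w => Cderiv f w * g w)%C); [|exact Hz].
apply holoD_mult; [apply holoD_Cderiv|]; assumption.
Qed.

(** * Suprema and the associated weight *)

(** The bound [M] excludes [p_infty], and the value at 0 excludes [m_infty]. *)
Lemma supD_finite F M : (forall z, inD z -> F z <= M) ->
  is_finite (supD F) /\ real (supD F) <= M.
Proof.
intros H; unfold supD.
match goal with |- is_finite (Lub_Rbar ?E) /\ _ => destruct (Lub_Rbar_correct E) as [H1 H2];
  assert (Hub := H2 (Finite M)); assert (H0 := H1 (F 0)); destruct (Lub_Rbar E) as [s| |] end.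
- split; [reflexivity|]; apply Hub; intros x [z [Hz ->]]; apply H, Hz.
- exfalso; apply Hub; intros x [z [Hz ->]]; apply H, Hz.
- exfalso; apply H0; exists (RtoC 0); split; [apply inD_0|reflexivity].
Qed.

Lemma supD_ub F z : is_finite (supD F) -> inD z -> F z <= real (supD F).
Proof.
intros Hf Hz; unfold supD in *.
match goal with |- _ <= real (Lub_Rbar ?E) => destruct (Lub_Rbar_correct E) as [H1 _] end.
assert (H := H1 (F z) ltac:(exists z; auto)).
rewrite <- Hf in H; exact H.
Qed.

Lemma weight_le_0 nu z : weight nu -> inD z -> nu z <= nu (RtoC 0).
Proof.
intros (_ & _ & _ & H) Hz; apply H; [apply inD_0|exact Hz|].
rewrite Cmod_0; apply Cmod_ge_0.
Qed.

Lemma weight_pos nu z : weight nu -> inD z -> 0 <= nu z.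
Proof. intros (H & _) Hz; apply H, Hz. Qed.

Lemma in_Hinf_ball nu f : holoD f -> (forall z, inD z -> nu z * Cmod (f z) <= 1) ->
  in_Hinf nu f /\ Rbar_le (Hinf_norm nu f) 1.
Proof.
intros Hf H; destruct (supD_finite (fun z => nu z * Cmod (f z)) 1 H) as [H1 H2].
split; [split; [exact Hf|exact H1]|].
unfold Hinf_norm; rewrite <- H1; exact H2.
Qed.

Lemma Hinf_ball_bound nu f z : in_Hinf nu f -> Rbar_le (Hinf_norm nu f) 1 -> inD z ->
  nu z * Cmod (f z) <= 1.
Proof.
intros [_ Hf] H Hz.
apply Rle_trans with (1 := supD_ub (fun z => nu z * Cmod (f z)) z Hf Hz).
unfold Hinf_norm in *; rewrite <- Hf in H; exact H.
Qed.

Lemma assoc_sup_ub nu f z x : holoD f -> (forall z, inD z -> nu z * Cmod (f z) <= 1) ->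
  assoc_sup nu z = Finite x -> Cmod (f z) <= x.
Proof.
intros Hf H E; unfold assoc_sup in E.
match type of E with Lub_Rbar ?S = _ => destruct (Lub_Rbar_correct S) as [H1 _] end.
rewrite E in H1; apply (H1 (Cmod (f z))).
destruct (in_Hinf_ball nu f Hf H) as [H3 H4]; exists f; auto.
Qed.

(** The constant [/ (nu 0 + 1)] lies in the unit ball; adding 1 covers the case where [nu] vanishes
    at 0. *)
Lemma assoc_sup_pos nu z : weight nu -> Rbar_lt 0 (assoc_sup nu z).
Proof.
intros Hnu.
assert (H0 := weight_pos nu 0 Hnu inD_0).
assert (Hc : 0 < / (nu (RtoC 0) + 1)) by (apply Rinv_0_lt_compat; lra).
unfold assoc_sup.
match goal with |- Rbar_lt _ (Lub_Rbar ?S) => destruct (Lub_Rbar_correct S) as [H1 _] end.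
apply Rbar_lt_le_trans with (Finite (/ (nu (RtoC 0) + 1))); [exact Hc|].
apply H1; exists (fun _ => RtoC (/ (nu (RtoC 0) + 1))).
rewrite Cmod_R, Rabs_pos_eq by lra.
rewrite <- and_assoc; split; [|reflexivity].
apply in_Hinf_ball; [apply holoD_const|].
intros w Hw; rewrite Cmod_R, Rabs_pos_eq by lra.
assert (H := weight_le_0 nu w Hnu Hw).
apply Rle_trans with ((nu (RtoC 0) + 1) * / (nu (RtoC 0) + 1)); [|right; field; lra].
apply Rmult_le_compat_r; lra.
Qed.

Lemma assoc_weight_pos nu z : weight nu -> 0 <= assoc_weight nu z.
Proof.
intros Hnu; assert (H := assoc_sup_pos nu z Hnu); unfold assoc_weight.
destruct (assoc_sup nu z) as [s| |]; try lra.
apply Rlt_le, Rinv_0_lt_compat, H.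
Qed.

(** Scaling [h] into the unit ball and comparing with the supremum gives the bound. The scaling is
    by [N + eps], since [N] may be 0; if the supremum is infinite, the associated weight is 0 and
    nothing is left to show. *)
Lemma assoc_weight_bound nu h N z : weight nu -> holoD h -> 0 <= N ->
  (forall w, inD w -> nu w * Cmod (h w) <= N) -> assoc_weight nu z * Cmod (h z) <= N.
Proof.
intros Hnu Hh HN H; apply le_epsilon; intros eps Heps.
assert (Hs := assoc_sup_pos nu z Hnu); unfold assoc_weight.
destruct (assoc_sup nu z) as [s| |] eqn:E; try lra.
simpl in Hs.
assert (Hi : 0 < / (N + eps)) by (apply Rinv_0_lt_compat; lra).
assert (B := assoc_sup_ub nu (fun w => RtoC (/ (N + eps)) * h w)%C z s
  (holoD_scal _ h Hh)).
cbv beta in B; rewrite Cmod_mult, Cmod_R, Rabs_pos_eq in B by lra.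
assert (B' : / (N + eps) * Cmod (h z) <= s).
{ apply B; [|exact E]; intros w Hw.
  rewrite Cmod_mult, Cmod_R, Rabs_pos_eq by lra.
  specialize (H w Hw).
  replace 1 with (/ (N + eps) * (N + eps)) by (field; lra).
  rewrite (Rmult_comm (nu w)), Rmult_assoc, (Rmult_comm (Cmod _)).
  apply Rmult_le_compat_l; lra. }
apply (Rmult_le_compat_l (/ s * (N + eps))) in B'.
- replace (/ s * (N + eps) * (/ (N + eps) * Cmod (h z))) with (/ s * Cmod (h z)) in B'
    by (field; lra).
  replace (/ s * (N + eps) * s) with (N + eps) in B' by (field; lra).
  exact B'.
- apply Rmult_le_pos; [apply Rlt_le, Rinv_0_lt_compat, Hs|lra].
Qed.

(** For [A > 0] the hypothesis makes [K / A] an upper bound of the supremum. In particular the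
    supremum is finite, so the default value 0 of [assoc_weight] does not occur. *)
Lemma assoc_weight_ge nu z A K : weight nu -> 0 <= A -> 0 <= K ->
  (forall f, holoD f -> (forall w, inD w -> nu w * Cmod (f w) <= 1) -> inD z ->
     A * Cmod (f z) <= K) -> inD z -> A <= K * assoc_weight nu z.
Proof.
intros Hnu HA HK H Hz.
assert (Hs := assoc_sup_pos nu z Hnu).
destruct (Rle_lt_or_eq_dec 0 A HA) as [HA'|<-].
2:{ apply Rmult_le_pos; [exact HK|apply assoc_weight_pos, Hnu]. }
assert (Hle : Rbar_le (assoc_sup nu z) (K / A)).
{ apply Lub_Rbar_correct; intros x [f [Hf [Hn ->]]].
  assert (B := H f (proj1 Hf) (fun w Hw => Hinf_ball_bound nu f w Hf Hn Hw) Hz).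
  apply (Rmult_le_reg_l A); [exact HA'|].
  replace (A * (K / A)) with K by (field; lra); exact B. }
unfold assoc_weight; destruct (assoc_sup nu z) as [s| |]; try contradiction.
simpl in Hs, Hle.
apply (Rmult_le_reg_r s); [exact Hs|].
rewrite Rmult_assoc, Rinv_l, Rmult_1_r by lra.
apply (Rmult_le_compat_l A) in Hle; [|lra].
replace (A * (K / A)) with K in Hle by (field; lra); exact Hle.
Qed.

(** * The operator on the Bloch spaces *)

(** Near the boundary [nu * |f'|] is below 1; on the remaining closed disk [f'] is bounded and [nu]
    is at most its value at 0. *)
Lemma in_B0_Binf nu f : weight nu -> in_B0 nu f -> in_Binf nu f.
Proof.
intros Hnu [Hf H]; split; [exact Hf|].
destruct (H 1 Rlt_0_1) as [r [Hr Hr']].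
destruct (holoD_bounded (Cderiv f) (Rmax r 0) (holoD_Cderiv f Hf)) as [M [HM HM']].
{ split; [apply Rmax_r|apply Rmax_lub_lt; lra]. }
apply (supD_finite (fun z => nu z * Cmod (Cderiv f z)) (nu (RtoC 0) * M + 1)).
intros z Hz.
assert (N0 := weight_pos nu 0 Hnu inD_0).
assert (N1 := weight_pos nu z Hnu Hz).
assert (N2 := weight_le_0 nu z Hnu Hz).
assert (C0 := Cmod_ge_0 (Cderiv f z)).
destruct (Rle_lt_dec (Cmod z) (Rmax r 0)) as [Hz'|Hz'].
- apply Rle_trans with (nu (RtoC 0) * M); [|lra].
  apply Rmult_le_compat; auto.
- assert (Hz2 := Rle_lt_trans _ _ _ (Rmax_l r 0) Hz').
  specialize (Hr' z Hz Hz2); nra.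
Qed.

Lemma Bnorm_bound mu f z : in_Binf mu f -> inD z ->
  mu z * Cmod (Cderiv f z) <= Bnorm mu f.
Proof.
intros [_ Hf] Hz; unfold Bnorm.
assert (H := supD_ub (fun z => mu z * Cmod (Cderiv f z)) z Hf Hz).
fold (Bseminorm mu f) in H; generalize (Cmod_ge_0 (f (RtoC 0))); lra.
Qed.

(** Turns a function of the unit ball of [H^infty_nu] into a Bloch test function: the primitive
    vanishes at 0 and has derivative [h]. *)
Lemma cprimitive_Bnorm nu h : holoD h -> (forall z, inD z -> nu z * Cmod (h z) <= 1) ->
  in_Binf nu (cprimitive h) /\ Bnorm nu (cprimitive h) <= 1.
Proof.
intros Hh H.
destruct (supD_finite (fun z => nu z * Cmod (Cderiv (cprimitive h) z)) 1) as [H1 H2].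
{ intros z Hz; rewrite Cderiv_cprimitive by assumption; auto. }
split; [split; [apply holoD_cprimitive, Hh|exact H1]|].
unfold Bnorm; rewrite cprimitive_0, Cmod_0; unfold Bseminorm; lra.
Qed.

Lemma Bnorm_pos nu f : weight nu -> in_Binf nu f -> 0 <= Bnorm nu f.
Proof.
intros Hnu Hf; eapply Rle_trans; [|apply (Bnorm_bound nu f 0 Hf inD_0)].
apply Rmult_le_pos; [apply weight_pos; [exact Hnu|apply inD_0]|apply Cmod_ge_0].
Qed.

(** The test function has norm between 0 and 1, and [Rmax K 0] absorbs a possibly negative [K]. *)
Lemma Sg_test_bound g nu mu h z K : holoD g -> weight nu -> holoD h -> inD z ->
  (forall w, inD w -> nu w * Cmod (h w) <= 1) ->
  in_Binf mu (Sg g (cprimitive h)) ->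
  Bnorm mu (Sg g (cprimitive h)) <= K * Bnorm nu (cprimitive h) ->
  Cmod (g z) * mu z * Cmod (h z) <= Rmax K 0.
Proof.
intros Hg Hnu Hh Hz H1 Hin HB.
destruct (cprimitive_Bnorm nu h Hh H1) as [P1 P2].
assert (P3 := Bnorm_pos nu _ Hnu P1).
assert (H := Bnorm_bound mu _ z Hin Hz).
rewrite Cderiv_Sg in H by (auto using holoD_cprimitive).
rewrite Cderiv_cprimitive, Cmod_mult in H by assumption.
assert (K1 := Rmax_l K 0); assert (K2 := Rmax_r K 0).
replace (Cmod (g z) * mu z * Cmod (h z)) with (mu z * (Cmod (h z) * Cmod (g z))) by ring.
nra.
Qed.

Lemma Binf_cond2 g nu mu : holoD g -> weight nu -> weight mu ->
  Sg_bounded_Binf g nu mu -> cond2 g nu mu.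
Proof.
intros Hg Hnu Hmu [K HK]; exists (Rmax K 0); intros z Hz.
apply assoc_weight_ge; auto.
- apply Rmult_le_pos; [apply Cmod_ge_0|apply weight_pos; assumption].
- apply Rmax_r.
- intros h Hh H1 _.
  destruct (cprimitive_Bnorm nu h Hh H1) as [P1 P2].
  destruct (HK _ P1) as [Q1 Q2].
  apply (Sg_test_bound g nu mu h z K); assumption.
Qed.

Lemma cond2_pos g nu mu : weight nu -> cond2 g nu mu -> exists K, 0 <= K /\
  forall z, inD z -> Cmod (g z) * mu z <= K * assoc_weight nu z.
Proof.
intros Hnu [K HK]; exists (Rmax K 0); split; [apply Rmax_r|]; intros z Hz.
eapply Rle_trans; [apply HK, Hz|].
apply Rmult_le_compat_r; [apply assoc_weight_pos, Hnu|apply Rmax_l].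
Qed.

Lemma cond2_Binf g nu mu : holoD g -> weight nu -> weight mu ->
  cond2 g nu mu -> Sg_bounded_Binf g nu mu.
Proof.
intros Hg Hnu Hmu H; destruct (cond2_pos g nu mu Hnu H) as [K [HK0 HK]].
exists K; intros f [Hf Hfin].
set (N := real (Bseminorm nu f)).
assert (HN : forall z, inD z -> nu z * Cmod (Cderiv f z) <= N)
  by (intros z Hz; apply (supD_ub (fun z => nu z * Cmod (Cderiv f z)) z Hfin Hz)).
assert (HN0 : 0 <= N).
{ eapply Rle_trans; [|apply (HN 0 inD_0)].
  apply Rmult_le_pos; [apply weight_pos; [exact Hnu|apply inD_0]|apply Cmod_ge_0]. }
destruct (supD_finite (fun z => mu z * Cmod (Cderiv (Sg g f) z)) (K * N)) as [H1 H2].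
{ intros z Hz; rewrite Cderiv_Sg, Cmod_mult by assumption.
  assert (B := assoc_weight_bound nu (Cderiv f) N z Hnu (holoD_Cderiv f Hf) HN0 HN).
  apply (Rmult_le_compat_l K) in B; [|exact HK0].
  specialize (HK z Hz).
  apply (Rmult_le_compat_r (Cmod (Cderiv f z))) in HK; [|apply Cmod_ge_0].
  lra. }
split; [split; [apply holoD_Sg; assumption|exact H1]|].
(* [Sg g f] vanishes at 0, so only its seminorm counts, while [Cmod (f 0)] merely enlarges the
   right-hand side. *)
unfold Bnorm; rewrite Sg_cprimitive, cprimitive_0, Cmod_0, <- Sg_cprimitive.
unfold Bseminorm at 1; fold N; generalize (Cmod_ge_0 (f (RtoC 0))); nra.
Qed.

(** * Dilations and the little Bloch spaces *)

Lemma dilation_Hinf_bound nu h rho N : weight nu -> 0 <= rho <= 1 ->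
  (forall w, inD w -> nu w * Cmod (h w) <= N) ->
  forall w, inD w -> nu w * Cmod (h (RtoC rho * w)%C) <= N.
Proof.
intros Hnu Hr H w Hw.
assert (Hrw := scaled_in_D w rho Hw Hr).
eapply Rle_trans; [|apply (H _ Hrw)].
apply Rmult_le_compat_r; [apply Cmod_ge_0|].
apply Hnu; [exact Hrw|exact Hw|].
rewrite Cmod_mult, Cmod_R, Rabs_pos_eq by lra; generalize (Cmod_ge_0 w); nra.
Qed.

Lemma dilation_bounded h rho : holoD h -> 0 <= rho < 1 ->
  exists M, 0 <= M /\ forall w, inD w -> Cmod (h (RtoC rho * w)%C) <= M.
Proof.
intros Hh Hr; destruct (holoD_bounded h rho Hh Hr) as [M [HM H]].
exists M; split; [exact HM|]; intros w Hw; apply H; unfold inD in Hw.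
rewrite Cmod_mult, Cmod_R, Rabs_pos_eq by lra; generalize (Cmod_ge_0 w); nra.
Qed.

Lemma B0_cond2 g nu mu : holoD g -> weight nu -> weight mu -> typical nu ->
  Sg_bounded_B0 g nu mu -> cond2 g nu mu.
Proof.
intros Hg Hnu Hmu Hty [K HK]; exists (Rmax K 0); intros z Hz.
assert (HA : 0 <= Cmod (g z) * mu z)
  by (apply Rmult_le_pos; [apply Cmod_ge_0|apply weight_pos; assumption]).
apply assoc_weight_ge; auto; [apply Rmax_r|].
intros h Hh H1 _.
set (A := Cmod (g z) * mu z) in *.
apply le_epsilon; intros eps Heps.
destruct (proj1 (continuous_C_loc h z)
  (cderiv_continuous h z _ (Cderiv_correct h z Hh Hz)) (eps / (A + 1))) as [d [Hd Hd']].
{ apply Rdiv_lt_0_compat; lra. }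
(* [rho = 1 - theta] moves [z] by [theta * Cmod z < d], and [theta <= 1 / 2] keeps [rho] in
   [[0, 1)]. *)
set (theta := Rmin (d / 2) (1 / 2)).
assert (T1 : theta <= d / 2) by apply Rmin_l.
assert (T2 : theta <= 1 / 2) by apply Rmin_r.
assert (T0 : 0 < theta) by (apply Rmin_glb_lt; lra).
set (rho := 1 - theta).
assert (Hr : 0 <= rho < 1) by (unfold rho; lra).
set (hr := fun w => h (RtoC rho * w)%C).
assert (Hhr : holoD hr) by (apply holoD_dilation; [exact Hh|lra]).
assert (Hhr1 : forall w, inD w -> nu w * Cmod (hr w) <= 1)
  by (apply dilation_Hinf_bound; auto; lra).
destruct (dilation_bounded h rho Hh Hr) as [M [HM HhM]].
(* The dilation [hr] is bounded on the disk, so typicality of [nu] forces [nu * |hr|] to 0 at the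
   boundary; [h] itself need not have this property. *)
assert (HB0 : in_B0 nu (cprimitive hr)).
{ split; [apply holoD_cprimitive, Hhr|]; intros e He.
  destruct (Hty (e / (M + 1))) as [r [Hr1 Hr2]]; [apply Rdiv_lt_0_compat; lra|].
  exists r; split; [exact Hr1|]; intros w Hw Hrw.
  rewrite Cderiv_cprimitive by assumption.
  specialize (Hr2 w Hw Hrw).
  apply (Rmult_lt_compat_r (M + 1)) in Hr2; [|lra].
  replace (e / (M + 1) * (M + 1)) with e in Hr2 by (field; lra).
  eapply Rle_lt_trans; [|exact Hr2].
  apply Rmult_le_compat_l; [apply weight_pos; assumption|].
  specialize (HhM w Hw); unfold hr; lra. }
destruct (HK _ HB0) as [Q1 Q2].
assert (B := Sg_test_bound g nu mu hr z K Hg Hnu Hhr Hz Hhr1 (in_B0_Binf mu _ Hmu Q1) Q2).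
fold A in B.
assert (Hclose : Cmod (hr z - h z) < eps / (A + 1)).
{ apply Hd'.
  replace (RtoC rho * z - z)%C with (RtoC (- theta) * z)%C
    by (unfold rho; rewrite RtoC_minus, RtoC_opp; ring).
  rewrite Cmod_mult, Cmod_R, Rabs_Ropp, Rabs_pos_eq by lra.
  unfold inD in Hz; generalize (Cmod_ge_0 z); nra. }
assert (T := Cmod_minus_triangle (h z) (hr z)); rewrite Cmod_minus_sym in T.
assert (H3 : Cmod (h z) <= Cmod (hr z) + eps / (A + 1)) by lra.
apply (Rmult_le_compat_l A) in H3; [|exact HA].
assert (H4 : A * (eps / (A + 1)) <= eps).
{ replace eps with ((A + 1) * (eps / (A + 1))) at 2 by (field; lra).
  apply Rmult_le_compat_r; [apply Rlt_le, Rdiv_lt_0_compat|]; lra. }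
lra.
Qed.

Lemma bernoulli_minus x n : 0 <= x <= 1 -> 1 - INR n * x <= (1 - x) ^ n.
Proof.
intros Hx; induction n as [|n IH]; [simpl; lra|].
rewrite S_INR; simpl; assert (0 <= INR n) by apply pos_INR.
apply Rle_trans with ((1 - x) * (1 - INR n * x)); [|apply Rmult_le_compat_l; lra].
assert (0 <= INR n * x * x) by (repeat apply Rmult_le_pos; lra); lra.
Qed.

Lemma assoc_weight_typical nu : weight nu -> typical nu -> typical (assoc_weight nu).
Proof.
intros Hnu Hty eps Heps.
(* The final estimate is [assoc_weight nu z <= 2 * e], which a third of [eps] makes strict. *)
set (e := eps / 3); assert (He : 0 < e) by (unfold e; lra).
assert (N0 := weight_pos nu 0 Hnu inD_0).
destruct (Hty e He) as [r [Hr Hr']].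
set (R0 := Rmax r 0).
assert (HR : 0 <= R0 < 1) by (split; [apply Rmax_r|apply Rmax_lub_lt; lra]).
destruct (pow_lt_1_zero R0 (Rabs_def1 R0 1 ltac:(lra) ltac:(lra)) (e / (nu (RtoC 0) + 1)))
  as [n Hn]; [apply Rdiv_lt_0_compat; lra|].
specialize (Hn n (Nat.le_refl n)).
rewrite Rabs_pos_eq in Hn by (apply pow_le; lra).
(* For [Cmod w <= R0] the power is small by the choice of [n]; beyond [R0] the weight itself is
   small and the power is at most 1. *)
assert (Hpow : forall w, inD w -> nu w * Cmod (w ^ n) <= e).
{ intros w Hw; rewrite Cmod_pow; assert (Hw0 := Cmod_ge_0 w).
  assert (N1 := weight_pos nu w Hnu Hw); assert (N2 := weight_le_0 nu w Hnu Hw).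
  assert (P0 : 0 <= Cmod w ^ n) by (apply pow_le, Hw0).
  destruct (Rle_lt_dec (Cmod w) R0) as [Hw'|Hw'].
  - assert (P1 : Cmod w ^ n <= R0 ^ n) by (apply pow_incr; lra).
    apply Rle_trans with ((nu (RtoC 0) + 1) * (e / (nu (RtoC 0) + 1))).
    + apply Rmult_le_compat; lra.
    + right; field; lra.
  - specialize (Hr' w Hw (Rle_lt_trans _ _ _ (Rmax_l r 0) Hw')).
    assert (P1 : Cmod w ^ n <= 1 ^ n) by (apply pow_incr; unfold inD in Hw; lra).
    rewrite pow1 in P1; nra. }
assert (Hn0 : 0 <= INR n) by apply pos_INR.
(* Chosen so that [INR n * x <= 1 / 2]: by Bernoulli, [Cmod z ^ n >= 1 / 2] once
   [Cmod z > 1 - x]. *)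
set (x := / (2 * (INR n + 1))).
assert (Hx0 : 0 < x) by (apply Rinv_0_lt_compat; lra).
assert (Hx1 : x * (2 * (INR n + 1)) = 1) by (apply Rinv_l; lra).
exists (1 - x); split; [lra|]; intros z Hz Hxz.
assert (B := assoc_weight_bound nu (fun w => w ^ n)%C e z Hnu (holoD_pow n) (Rlt_le _ _ He) Hpow).
cbv beta in B; rewrite Cmod_pow in B.
assert (x <= 1) by nra.
assert (P1 : (1 - x) ^ n <= Cmod z ^ n) by (apply pow_incr; lra).
assert (P2 := bernoulli_minus x n ltac:(lra)).
assert (P3 : 1 / 2 <= Cmod z ^ n) by nra.
assert (A0 := assoc_weight_pos nu z Hnu).
unfold e in *; nra.
Qed.

Lemma assoc_weight_little_o nu h : weight nu -> typical nu -> holoD h ->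
  (forall eps, 0 < eps -> exists r, r < 1 /\
     forall z, inD z -> r < Cmod z -> nu z * Cmod (h z) < eps) ->
  forall eps, 0 < eps -> exists r, r < 1 /\
     forall z, inD z -> r < Cmod z -> assoc_weight nu z * Cmod (h z) < eps.
Proof.
intros Hnu Hty Hh H eps Heps.
assert (N0 := weight_pos nu 0 Hnu inD_0).
destruct (H (eps / 4)) as [r [Hr Hr']]; [lra|].
set (R0 := Rmax r 0).
assert (HR : 0 <= R0 < 1) by (split; [apply Rmax_r|apply Rmax_lub_lt; lra]).
assert (HrR : r <= R0) by apply Rmax_l.
set (R1 := (1 + R0) / 2).
destruct (holoD_lipschitz h R1 Hh ltac:(unfold R1; lra)) as [L [HL HLip]].
assert (HNL : 0 <= nu (RtoC 0) * L) by (apply Rmult_le_pos; assumption).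
(* The first bound gives [rho >= R1], so [Cmod w > R1] implies [rho * Cmod w > R1 ^ 2 >= R0]; the
   second makes the Lipschitz error on the disk of radius [R1] at most [eps / 4] after weighting. *)
set (theta := Rmin ((1 - R0) / 2) (eps / (4 * (nu (RtoC 0) * L + 1)))).
assert (T1 : theta <= (1 - R0) / 2) by apply Rmin_l.
assert (T2 : theta * (nu (RtoC 0) * L + 1) <= eps / 4).
{ apply Rle_trans with (eps / (4 * (nu (RtoC 0) * L + 1)) * (nu (RtoC 0) * L + 1)).
  - apply Rmult_le_compat_r; [lra|apply Rmin_r].
  - right; field; lra. }
assert (T0 : 0 < theta) by (apply Rmin_glb_lt; [lra|apply Rdiv_lt_0_compat; lra]).
set (rho := 1 - theta).
assert (Hrho : 0 <= rho < 1) by (unfold rho; lra).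
assert (Hdiff : forall w, inD w -> nu w * Cmod (h w - h (RtoC rho * w)%C) <= eps / 2).
{ intros w Hw; assert (Hw' := Hw); unfold inD in Hw'.
  assert (W0 := Cmod_ge_0 w).
  assert (Hrw := scaled_in_D w rho Hw ltac:(lra)).
  assert (E : Cmod (RtoC rho * w) = rho * Cmod w)
    by (rewrite Cmod_mult, Cmod_R, Rabs_pos_eq; lra).
  assert (N1 := weight_pos nu w Hnu Hw); assert (N2 := weight_le_0 nu w Hnu Hw).
  destruct (Rle_lt_dec (Cmod w) R1) as [Hw1|Hw1].
  - assert (B := HLip w (RtoC rho * w)%C Hw1 ltac:(rewrite E; unfold R1 in *; nra)).
    replace (w - RtoC rho * w)%C with (RtoC theta * w)%C in B
      by (unfold rho; rewrite RtoC_minus; ring).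
    rewrite Cmod_mult, Cmod_R, Rabs_pos_eq in B by lra.
    apply Rle_trans with (nu (RtoC 0) * (L * theta)); [|nra].
    apply Rmult_le_compat; auto using Cmod_ge_0.
    eapply Rle_trans; [exact B|]; apply Rmult_le_compat_l; [exact HL|nra].
  (* Both [w] and [rho w] lie where [nu * |h| < eps / 4], and [nu w <= nu (rho w)] because the
     weight decreases. *)
  - assert (Hbig : R0 < rho * Cmod w) by (unfold rho, R1 in *; nra).
    assert (B1 := Hr' w Hw ltac:(unfold R1 in *; lra)).
    assert (B2 := Hr' (RtoC rho * w)%C Hrw ltac:(rewrite E; lra)).
    assert (B3 : nu w <= nu (RtoC rho * w)%C) by (apply Hnu; auto; rewrite E; nra).
    assert (B4 : nu w * Cmod (h (RtoC rho * w)%C) <= nu (RtoC rho * w)%C * Cmod (h (RtoC rho * w)%C))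
      by (apply Rmult_le_compat_r; [apply Cmod_ge_0|exact B3]).
    assert (T : Cmod (h w - h (RtoC rho * w)%C) <= Cmod (h w) + Cmod (h (RtoC rho * w)%C)).
    { unfold Cminus; eapply Rle_trans; [apply Cmod_triangle|]; rewrite Cmod_opp; lra. }
    apply (Rmult_le_compat_l (nu w)) in T; [|exact N1]; lra. }
assert (Hhr : holoD (fun w => h (RtoC rho * w)%C)) by (apply holoD_dilation; [exact Hh|lra]).
destruct (dilation_bounded h rho Hh Hrho) as [M [HM HhM]].
destruct (assoc_weight_typical nu Hnu Hty (eps / (2 * (M + 1)))) as [r2 [Hr2 Hr2']].
{ apply Rdiv_lt_0_compat; lra. }
exists r2; split; [exact Hr2|]; intros z Hz Hrz.
assert (A0 := assoc_weight_pos nu z Hnu).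
(* The uniform bound on [nu * |h - h_rho|] passes to the associated weight at no cost; the other
   half of [eps] pays for [h_rho], bounded by [M]. *)
assert (B1 := assoc_weight_bound nu _ (eps / 2) z Hnu (holoD_minus _ _ Hh Hhr) ltac:(lra) Hdiff).
cbv beta in B1.
specialize (Hr2' z Hz Hrz); specialize (HhM z Hz).
apply (Rmult_lt_compat_r (M + 1)) in Hr2'; [|lra].
replace (eps / (2 * (M + 1)) * (M + 1)) with (eps / 2) in Hr2' by (field; lra).
assert (T := Cmod_minus_triangle (h z) (h (RtoC rho * z)%C)).
assert (T' : Cmod (h z) <= Cmod (h z - h (RtoC rho * z)%C) + M) by lra.
apply (Rmult_le_compat_l (assoc_weight nu z)) in T'; [|exact A0].
nra.
Qed.

(** The norm estimate is inherited from the large spaces, leaving only decay at the boundary, where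
    [mu * |f' g|] is at most [K2] times the associated weight times [|f'|]. *)
Lemma cond2_B0 g nu mu : holoD g -> weight nu -> weight mu -> typical nu ->
  cond2 g nu mu -> Sg_bounded_B0 g nu mu.
Proof.
intros Hg Hnu Hmu Hty Hc2.
destruct (cond2_Binf g nu mu Hg Hnu Hmu Hc2) as [K HK].
destruct (cond2_pos g nu mu Hnu Hc2) as [K2 [HK0 HK2]].
exists K; intros f Hf; split; [|apply HK, in_B0_Binf; assumption].
destruct Hf as [Hf H]; split; [apply holoD_Sg; assumption|]; intros eps Heps.
destruct (assoc_weight_little_o nu (Cderiv f) Hnu Hty (holoD_Cderiv f Hf) H (eps / (K2 + 1)))
  as [r [Hr Hr']]; [apply Rdiv_lt_0_compat; lra|].
exists r; split; [exact Hr|]; intros z Hz Hrz.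
rewrite Cderiv_Sg, Cmod_mult by assumption.
specialize (Hr' z Hz Hrz); specialize (HK2 z Hz).
apply (Rmult_lt_compat_l (K2 + 1)) in Hr'; [|lra].
replace ((K2 + 1) * (eps / (K2 + 1))) with eps in Hr' by (field; lra).
apply (Rmult_le_compat_r (Cmod (Cderiv f z))) in HK2; [|apply Cmod_ge_0].
assert (0 <= assoc_weight nu z * Cmod (Cderiv f z))
  by (apply Rmult_le_pos; [apply assoc_weight_pos, Hnu|apply Cmod_ge_0]).
lra.
Qed.

Theorem theorem4 (g : C -> C) (nu mu : C -> R) :
  holoD g -> weight nu -> weight mu ->
  (Sg_bounded_Binf g nu mu <-> cond2 g nu mu) /\
  (typical nu -> typical mu ->
     (Sg_bounded_Binf g nu mu <-> Sg_bounded_B0 g nu mu) /\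
     (cond2 g nu mu <-> Sg_bounded_B0 g nu mu)).
Proof.
intros Hg Hnu Hmu.
assert (H12 : Sg_bounded_Binf g nu mu <-> cond2 g nu mu)
  by (split; [apply Binf_cond2|apply cond2_Binf]; assumption).
split; [exact H12|]; intros Hty _.
assert (H23 : cond2 g nu mu <-> Sg_bounded_B0 g nu mu)
  by (split; [apply cond2_B0|apply B0_cond2]; assumption).
split; [rewrite H12|]; exact H23.
Qed.
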